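(* Let $\alpha\in(0,1]$, let $\mathcal{L}$ be the jump uncertainty set in the context, and let $\{Z_i\}$ be an i.i.d. sequence of $\mathbb{R}^d$-valued random variables on a sublinear expectation space $(\Omega,\mathcal{H},\hat{\mathbb{E}})$ with $\hat{\mathbb{E}}[|Z_i|]=\infty$ and $S_n=\sum_{i=1}^nZ_i$, satisfying: (A1) there is $0<\delta<\alpha$ with $M_\delta:=\sup_n\hat{\mathbb{E}}[|n^{-1/\alpha}S_n|^\delta]<\infty$; (A2) there is a function $l$ on $[0,1]$ with $l(s)\to0$ as $s\to0$ such that for each $\varphi\in C_b^3(\mathbb{R}^d)$, $\frac1s\big|\hat{\mathbb{E}}[\varphi(x+s^{1/\alpha}Z_1)-\varphi(x)]-s\sup_{F_\mu\in\mathcal{L}}\int\delta^\alpha_\lambda\varphi(x)F_\mu(d\lambda)\big|\le l(s)$ for all $x\in\mathbb{R}^d$. Then for $\varphi\in C_b^3(\mathbb{R}^d)$ and $s\in[0,1]$, $$\lim_{n\to\infty}\Big|\hat{\mathbb{E}}\big[\varphi(x+(s/n)^{1/\alpha}S_n)\big]-\varphi(x)-s\sup_{F_\mu\in\mathcal{L}}\int_{\mathbb{R}^d}\delta^\alpha_\lambda\varphi(x)F_\mu(d\lambda)\Big|=o(s)$$ uniformly in $x\in\mathbb{R}^d$, where $o(s)/s\to0$ as $s\to0$.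
   Context: Sublinear expectation space: $\hat{\mathbb{E}}$ monotone, constant preserving, sub-additive, positively homogeneous on a space $\mathcal{H}$ closed under composition with bounded Lipschitz functions; random variables need only have $\varphi(X)\in\mathcal{H}$ for bounded Lipschitz $\varphi$. I.i.d.: $Z_{i+1}\overset{d}{=}Z_i$ and $Z_{i+1}$ independent from $(Z_1,\dots,Z_i)$, with independence meaning $\hat{\mathbb{E}}[\varphi(X,Y)]=\hat{\mathbb{E}}[\hat{\mathbb{E}}[\varphi(x,Y)]_{x=X}]$. $F_\mu(B)=\int_S\mu(dz)\int_0^\infty\mathbb{1}_B(rz)r^{-1-\alpha}dr$ for a symmetric finite measure $\mu$ on the unit sphere $S$, and $\mathcal{L}=\{F_\mu:\mu(S)\in(\underline{\Lambda},\overline{\Lambda})\}$ for given $\underline{\Lambda},\overline{\Lambda}>0$. $\delta^\alpha_\lambda\varphi(x)=\varphi(x+\lambda)-\varphi(x)-\langle D\varphi(x),\lambda\mathbb{1}_{\{|\lambda|\le1\}}\rangle$ if $\alpha=1$, $=\varphi(x+\lambda)-\varphi(x)$ if $\alpha\in(0,1)$. $C_b^3$: uniformly bounded derivatives up to order 3. *)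

(* Defs.v *)
From HB Require Import structures.
From mathcomp Require Import all_boot all_order all_algebra.
From mathcomp Require Import all_classical all_reals all_analysis.
Set Implicit Arguments. Unset Strict Implicit. Unset Printing Implicit Defensive.
Import Order.TTheory GRing.Theory Num.Theory.
Import numFieldNormedType.Exports.
Local Open Scope classical_set_scope.
Local Open Scope ring_scope.

Section Defs.
Variable R : realType.

Definition eucl (d : nat) (x : 'rV[R]_d) : R :=
  Num.sqrt (\sum_(i < d) x ord0 i ^+ 2).

(** Bounded Lipschitz functions on a (finite-dimensional) matrix space
    (Lipschitz w.r.t. the library norm; all norms are equivalent here). *)
Definition bLip (m n : nat) (phi : 'M[R]_(m, n) -> R) : Prop :=
  (exists M : R, forall x, `|phi x| <= M) /\
  (exists L : R, forall x y, `|phi x - phi y| <= L * `|x - y|).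

(** Sublinear expectation space (Omega, H, E).  E is given as a total map,
    its axioms are only required on H. *)
Definition sublinear_expectation (Omega : Type)
    (H : set (Omega -> R)) (E : (Omega -> R) -> R) : Prop :=
  [/\ (forall c : R, H (fun _ => c)),
      (forall X Y, H X -> H Y -> H (X \+ Y)),
      (forall (c : R) X, H X -> H (fun w => c * X w)),
      (forall (m n : nat) (X : Omega -> 'M[R]_(m, n)),
          (forall i j, H (fun w => X w i j)) ->
          forall phi, bLip phi -> H (phi \o X))
    & [/\ (forall X Y, H X -> H Y -> (forall w, X w <= Y w) -> E X <= E Y),
          (forall c : R, E (fun _ => c) = c),
          (forall X Y, H X -> H Y -> E (X \+ Y) <= E X + E Y)
        & (forall (lam : R) X, H X -> 0 <= lam ->
              E (fun w => lam * X w) = lam * E X)]].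

Definition rand_mx (Omega : Type) (H : set (Omega -> R)) (m n : nat)
    (X : Omega -> 'M[R]_(m, n)) : Prop :=
  forall phi, bLip phi -> H (phi \o X).

Definition indep (Omega : Type) (E : (Omega -> R) -> R) (m d : nat)
    (X : Omega -> 'M[R]_(m, d)) (Y : Omega -> 'rV[R]_d) : Prop :=
  forall phi : 'M[R]_(m + 1, d) -> R, bLip phi ->
    E (fun w => phi (col_mx (X w) (Y w))) =
    E (fun w => E (fun w' => phi (col_mx (X w) (Y w')))).

Definition ident_distr (Omega : Type) (E : (Omega -> R) -> R) (d : nat)
    (X Y : Omega -> 'rV[R]_d) : Prop :=
  forall phi : 'rV[R]_d -> R, bLip phi -> E (phi \o X) = E (phi \o Y).

(** First i variables Z_1,...,Z_i (here Z 0, ..., Z (i-1)) as an i x d matrix. *)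
Definition first_rows (Omega : Type) (d : nat) (Z : nat -> Omega -> 'rV[R]_d)
    (i : nat) : Omega -> 'M[R]_(i, d) :=
  fun w => \matrix_(j < i, k < d) Z j w ord0 k.

(** i.i.d. sequence (Z 0 = Z_1, Z 1 = Z_2, ...). *)
Definition iid (Omega : Type) (H : set (Omega -> R)) (E : (Omega -> R) -> R)
    (d : nat) (Z : nat -> Omega -> 'rV[R]_d) : Prop :=
  (forall i, rand_mx H (first_rows Z i)) /\
  (forall i, rand_mx H (Z i)) /\
  (forall i, ident_distr E (Z i.+1) (Z i)) /\
  (forall i, indep E (first_rows Z i.+1) (Z i.+1)).

(** Extension of E to nonnegative functions f(X) (f possibly unbounded):
    sup of E[psi(X)] over bounded Lipschitz 0 <= psi <= f. *)
Definition Eup (Omega : Type) (E : (Omega -> R) -> R) (d : nat)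
    (X : Omega -> 'rV[R]_d) (f : 'rV[R]_d -> R) : \bar R :=
  ereal_sup [set (E (psi \o X))%:E | psi in
     [set psi : 'rV[R]_d -> R | bLip psi /\ forall x, 0 <= psi x <= f x]].

Definition partial (d : nat) (f : 'rV[R]_d -> R) (i : 'I_d) : 'rV[R]_d -> R :=
  fun x => 'D_(delta_mx ord0 i) f x.

Definition iter_partial (d : nat) (f : 'rV[R]_d -> R) (s : seq 'I_d) :=
  foldr (fun i g => partial g i) f s.

Definition Cb3 (d : nat) (f : 'rV[R]_d -> R) : Prop :=
  forall s : seq 'I_d, (size s <= 3)%N ->
    [/\ (size s < 3)%N -> forall i x, derivable (iter_partial f s) x (delta_mx ord0 i),
        continuous (iter_partial f s)
      & exists M : R, forall x, `|iter_partial f s x| <= M].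

Definition jump_delta (alpha : R) (d : nat) (phi : 'rV[R]_d -> R)
    (x lam : 'rV[R]_d) : R :=
  if alpha == 1 then
    phi (x + lam) - phi x - (if eucl lam <= 1 then 'D_lam phi x else 0)
  else phi (x + lam) - phi x.

Definition RdB (d : nat) := g_sigma_algebraType (@open 'rV[R]_d).

Definition sphere (d : nat) : set (RdB d) := [set z : 'rV[R]_d | eucl z = 1].

Definition admissible (d : nat) (Llo Lhi : R)
    (mu : {measure set (RdB d) -> \bar R}) : Prop :=
  [/\ mu (~` @sphere d) = 0%E,
      (forall A : set (RdB d), measurable A ->
          mu [set z : RdB d | A (- (z : 'rV[R]_d))] = mu A)
    & (Llo%:E < mu setT < Lhi%:E)%E].

(** int g dF_mu, with F_mu(B) = int_S mu(dz) int_0^oo 1_B(r z) r^{-1-alpha} dr. *)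
Definition int_Fmu (alpha : R) (d : nat) (mu : {measure set (RdB d) -> \bar R})
    (g : 'rV[R]_d -> R) : \bar R :=
  (\int[mu]_(z in @sphere d)
     \int[@lebesgue_measure R]_(r in [set r : R | (0 < r)%R])
        ((g (r *: (z : 'rV[R]_d)) * r `^ (- 1 - alpha))%R)%:E)%E.

Definition jump_sup (alpha Llo Lhi : R) (d : nat) (phi : 'rV[R]_d -> R)
    (x : 'rV[R]_d) : R :=
  sup [set v : R | exists mu : {measure set (RdB d) -> \bar R},
         admissible Llo Lhi mu /\ v = fine (int_Fmu alpha mu (jump_delta alpha phi x))].

Definition partial_sum (Omega : Type) (d : nat) (Z : nat -> Omega -> 'rV[R]_d)
    (n : nat) : Omega -> 'rV[R]_d :=
  fun w => \sum_(i < n) Z i w.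

End Defs.

(* Main.v *)
(** Write [T_h v x := E [v (x + h^(1/alpha) Z_1)]]. Independence turns
    [E [phi (x + (s/n)^(1/alpha) S_n)]] into the [n]-th iterate of [T_(s/n)] at
    [phi], and [T_h] is a monotone, sublinear, translation invariant contraction
    of bounded Lipschitz functions with [(T_h psi - psi) / h --> G psi] for
    [psi] in [C_b^3], by (A2). No further information on the generator [G] is
    needed.

    Existence of the limit: iterates with two different steps are compared in
    the spirit of Krylov. By sublinearity (Jensen) averaging over translates
    maps supersolutions of a scheme to supersolutions, so a mollified iterate of
    one scheme is smooth and dominates, up to small errors, the iterates of the
    other one; exchanging the roles of the two schemes shows that the iterates
    form a Cauchy sequence. The errors are uniform because (A2), applied to
    finitely many coordinate test functions, makes the difference quotients
    [(T_h psi - psi) / h] equicontinuous in [psi].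

    Expansion in [s]: the iterates are compared with [phi + t g], where [g] is
    a smooth uniform approximation of [G phi]. *)
Require Import Defs.
From HB Require Import structures.
From mathcomp Require Import all_boot all_order all_algebra.
From mathcomp Require Import all_classical all_reals all_analysis.
From mathcomp Require Import ring lra.
Import Order.TTheory GRing.Theory Num.Theory.
Import numFieldNormedType.Exports.
Local Open Scope classical_set_scope.
Local Open Scope ring_scope.

Set Implicit Arguments.
Unset Strict Implicit.
Unset Printing Implicit Defensive.

(** In (A2) the rate [l] may depend on the test function, while comparing two schemes needs one rate
    for all mollified iterates. These share fixed bounds at a given mollification scale, are totally
    bounded on balls, and by translation invariance need only be tested at the origin;
    equicontinuity then replaces them by finitely many representatives. The generator is known only
    through (A2), so its place is taken by a difference quotient with a fixed reference step [hs].
    For this quotient a uniform perturbation of the function costs at most a factor [2 / hs], so it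
    hardly varies along a fine time grid. The order of choices is therefore the scale [eps], the
    threshold [h0] it induces, the reference step [hs < h0], and last the steps [s / n] and
    [s / n']. Neither step need be a multiple of the other, but both are multiples of
    [s / (n * n')]; linear interpolation in time moves the iterates to this common grid. *)

Lemma mx_entry_le (R : realType) (m n : nat) (A : 'M[R]_(m, n)) i j :
  `|A i j| <= `|A|.
Proof.
rewrite [leRHS]/Num.norm/= mx_normrE; apply/bigmax_geP; right => /=.
by exists (i, j).
Qed.

(** * Row vectors, the sup norm and paths along the axes *)

Section row_norm.
Context {R : realType} {d : nat}.
Implicit Types x y : 'rV[R]_d.

Lemma norm_coord x i : `|x ord0 i| <= `|x|.
Proof. exact: mx_entry_le. Qed.

Lemma norm_le_coord x (c : R) :
  0 <= c -> (forall i, `|x ord0 i| <= c) -> `|x| <= c.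
Proof.
move=> c0 xc; rewrite [leLHS]/Num.norm/= mx_normrE; apply/bigmax_leP.
by split=> // -[i j] _ /=; rewrite (ord1 i).
Qed.

Lemma norm_coord_attained x : 0 < `|x| -> exists i, `|x| = `|x ord0 i|.
Proof.
move=> x0; have /mx_norm_neq0[[i j] /= xE] : mx_norm x != 0.
  by rewrite gt_eqF.
by exists j; rewrite [LHS]xE (ord1 i).
Qed.

Lemma norm_delta_le (i : 'I_d) : `|delta_mx ord0 i : 'rV[R]_d| <= 1.
Proof.
apply: norm_le_coord => // j; rewrite mxE.
by case: (_ && _); rewrite ?normr1 ?normr0.
Qed.

Lemma norm_scale_delta_le (i : 'I_d) (t : R) :
  `|t *: (delta_mx ord0 i : 'rV[R]_d)| <= `|t|.
Proof. by rewrite normrZ ler_piMr// norm_delta_le. Qed.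

Definition trunc_row (y : 'rV[R]_d) (k : nat) : 'rV[R]_d :=
  \row_j (if (j < k)%N then y ord0 j else 0).

Lemma norm_trunc_row y k : `|trunc_row y k| <= `|y|.
Proof.
apply: norm_le_coord => // j; rewrite mxE; case: ifP => _.
  exact: norm_coord.
by rewrite normr0.
Qed.

Lemma trunc_row0 y : trunc_row y 0 = 0.
Proof. by apply/rowP => j; rewrite !mxE. Qed.

Lemma trunc_row_full y : trunc_row y d = y.
Proof. by apply/rowP => j; rewrite !mxE ltn_ord. Qed.

Lemma trunc_rowS y (i : 'I_d) :
  trunc_row y i.+1 = trunc_row y i + y ord0 i *: delta_mx ord0 i.
Proof.
apply/rowP => j; rewrite !mxE eqxx/= ltnS leq_eqVlt.
have [->|ji] := eqVneq j i; first by rewrite eqxx ltnn mulr1 add0r.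
have /negbTE-> : nat_of_ord j != nat_of_ord i by [].
by rewrite mulr0 addr0.
Qed.

(** Going from [x] to [x + y] one coordinate at a time uses only increments of [f] along the axes.
    The slopes [c] are free: zero gives Lipschitz bounds, partial derivatives at a base point give a
    Taylor expansion. *)
Lemma coord_telescope (f : 'rV[R]_d -> R) (c : 'I_d -> R) (x y : 'rV[R]_d)
    (B : R) :
  (forall i z t, `|z| <= `|y| -> `|t| <= `|y| ->
     `|f (x + z + t *: delta_mx ord0 i) - f (x + z) - t * c i| <= B) ->
  `|f (x + y) - f x - \sum_i y ord0 i * c i| <= d%:R * B.
Proof.
move=> fB.
have -> : f (x + y) - f x =
    \sum_(i < d) (f (x + trunc_row y i.+1) - f (x + trunc_row y i)).
  rewrite -(big_mkord xpredT
    (fun k => f (x + trunc_row y k.+1) - f (x + trunc_row y k))).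
  rewrite (telescope_sumr (fun k => f (x + trunc_row y k)))//.
  by rewrite trunc_row_full trunc_row0 addr0.
rewrite -sumrB; apply: le_trans (ler_norm_sum _ _ _) _.
rewrite -[d in d%:R]card_ord -sum1_card natr_sum mulr_suml.
apply: ler_sum => i _; rewrite mul1r trunc_rowS addrA; apply: fB.
  exact: norm_trunc_row.
exact: norm_coord.
Qed.

End row_norm.

(** * Bounded Lipschitz functions with explicit constants *)

Section blip.
Context {R : realType} {m n : nat}.
Implicit Types v w : 'M[R]_(m, n) -> R.

(** [bLip] hides its constants; visible ones allow statements that are uniform over a whole class,
    such as all iterates of a scheme. *)
Definition blip (K L : R) v :=
  (forall x, `|v x| <= K) /\ (forall x y, `|v x - v y| <= L * `|x - y|).

Lemma blip_bLip K L v : blip K L v -> bLip v.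
Proof. by move=> [vK vL]; split; [exists K|exists L]. Qed.

Lemma bLip_blip v : bLip v -> exists K L : R, [/\ 0 < K, 0 < L & blip K L v].
Proof.
move=> [[K vK] [L vL]]; exists (`|K| + 1), (`|L| + 1); split.
- by rewrite ltr_wpDl.
- by rewrite ltr_wpDl.
split=> [x|x y].
  by apply: le_trans (vK x) _; rewrite (le_trans (ler_norm K))// lerDl.
apply: le_trans (vL x y) _; apply: ler_wpM2r => //.
by rewrite (le_trans (ler_norm L))// lerDl.
Qed.

Lemma blip_shift K L v z : blip K L v -> blip K L (fun x => v (z + x)).
Proof.
move=> [vK vL]; split=> // x y; apply: le_trans (vL _ _) _.
by rewrite opprD addrACA subrr add0r.
Qed.

Lemma blipN K L v : blip K L v -> blip K L (fun x => - v x).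
Proof.
move=> [vK vL]; split=> [x|x y]; first by rewrite normrN.
by rewrite -opprD normrN.
Qed.

Lemma blipD K L K' L' v w :
  blip K L v -> blip K' L' w -> blip (K + K') (L + L') (fun x => v x + w x).
Proof.
move=> [vK vL] [wK wL]; split=> [x|x y].
  by apply: le_trans (ler_normD _ _) _; apply: lerD.
have -> : v x + w x - (v y + w y) = (v x - v y) + (w x - w y) by ring.
by apply: le_trans (ler_normD _ _) _; rewrite mulrDl; apply: lerD.
Qed.

Lemma blipZ K L v c : blip K L v -> blip (`|c| * K) (`|c| * L) (fun x => c * v x).
Proof.
move=> [vK vL]; split=> [x|x y].
  by rewrite normrM; apply: ler_wpM2l.
by rewrite -mulrBr normrM -mulrA; apply: ler_wpM2l.
Qed.

Lemma bLip_cst c : @bLip R m n (fun=> c).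
Proof.
split; first by exists `|c|.
by exists 0 => x y; rewrite subrr normr0 mul0r.
Qed.

Lemma bLipD v w : bLip v -> bLip w -> bLip (fun x => v x + w x).
Proof.
move=> /bLip_blip[K [L [_ _ vb]]] /bLip_blip[K' [L' [_ _ wb]]].
exact: blip_bLip (blipD vb wb).
Qed.

Lemma bLipN v : bLip v -> bLip (fun x => - v x).
Proof. by move=> /bLip_blip[K [L [_ _ /blipN/blip_bLip]]]. Qed.

Lemma bLipB v w : bLip v -> bLip w -> bLip (fun x => v x - w x).
Proof. by move=> vb /bLipN; exact: bLipD. Qed.

Lemma bLipZ v c : bLip v -> bLip (fun x => c * v x).
Proof. by move=> /bLip_blip[K [L [_ _ vb]]]; exact: blip_bLip (blipZ c vb). Qed.

Lemma bLip_sum (I : Type) (r : seq I) (F : I -> 'M[R]_(m, n) -> R) :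
  (forall i, bLip (F i)) -> bLip (fun x => \sum_(i <- r) F i x).
Proof.
move=> Fb; elim: r => [|i r ih].
  by under eq_fun do rewrite big_nil; exact: bLip_cst.
by under eq_fun do rewrite big_cons; exact: bLipD.
Qed.

Lemma bLip_shift v z : bLip v -> bLip (fun x => v (z + x)).
Proof. by move=> /bLip_blip[K [L [_ _ /(blip_shift z)/blip_bLip]]]. Qed.

Lemma bLip_affine v z a : bLip v -> bLip (fun y => v (z + a *: y)).
Proof.
move=> [[K vK] [L vL]]; split; first by exists K.
exists (L * `|a|) => x y; apply: le_trans (vL _ _) _.
by rewrite opprD addrACA subrr add0r -scalerBr normrZ mulrA.
Qed.

Lemma blip_continuous K L v : blip K L v -> continuous v.
Proof.
move=> [_ vL] x; apply: (@cvgrPdist_le _ _ _ (nbhs x) _ _ _).2 => e e0.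
have L0 : 0 < `|L| + 1 by rewrite ltr_wpDl.
apply/nbhs_ballP; exists (e / (`|L| + 1)); first exact: divr_gt0.
move=> y /=; rewrite -ball_normE/= ltr_pdivlMr// => /ltW xy.
apply: le_trans (vL _ _) _; apply: le_trans xy; rewrite mulrC.
by apply: ler_wpM2l => //; rewrite (le_trans (ler_norm L))// lerDl.
Qed.

End blip.

(** * Antiderivatives on open half-lines *)

Section antiderivative.
Context {R : realType}.
Implicit Types F G f g : R -> R.

(* Restricting to [t > l] makes the Lebesgue integral from [l] to [t] an
   antiderivative. *)
Definition antider (l : R) F g := forall t : R, l < t -> is_derive t 1 F (g t).

Lemma antiderW l l' F g : l <= l' -> antider l F g -> antider l' F g.
Proof. by move=> ll' Fg t l't; apply: Fg; exact: le_lt_trans l't. Qed.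

Lemma antider_exists l g : continuous g -> exists F, antider l F g.
Proof.
move=> gc.
exists (fun x => \int[@lebesgue_measure R]_(t in [set` `[l, x]]) (g t)) => t lt_t.
have tt : t < t + 1 by rewrite ltrDl.
have ig : (@lebesgue_measure R).-integrable `[l, t + 1] (EFin \o g).
  apply: continuous_compact_integrable; first exact: segment_compact.
  exact: continuous_subspaceT.
have [dF FE] := continuous_FTC1_closed tt ig lt_t (gc t).
by apply: DeriveDef; [exact: dF|rewrite -derive1E; exact: FE].
Qed.

Lemma antider_MVT l F g a b : antider l F g -> l < a -> a <= b ->
  exists2 c, a <= c <= b & F b - F a = g c * (b - a).
Proof.
move=> Fg a2 ab; have [||c + E] := @MVT_segment R F g a b ab.
- move=> x; rewrite in_itv/= => /andP[ax _].
  by apply: Fg; exact: lt_trans ax.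
- apply: derivable_within_continuous => x; rewrite in_itv/= => /andP[ax _].
  by have [] := Fg x (lt_le_trans a2 ax).
by rewrite in_itv/=; exists c.
Qed.

Lemma antider_taylor l F g a t B : antider l F g -> l < a -> l < a + t ->
  (forall r, `|r| <= `|t| -> `|g (a + r) - g a| <= B) ->
  `|F (a + t) - F a - t * g a| <= B * `|t|.
Proof.
move=> Fg a2 at2 gB; have [t0|t0] := leP 0 t.
  have le_at : a <= a + t by rewrite lerDl.
  have [c /andP[ac cat] ->] := antider_MVT Fg a2 le_at.
  have -> : g c * (a + t - a) - t * g a = (g (a + (c - a)) - g a) * t.
    by rewrite [a + (c - a)]addrC subrK; ring.
  rewrite normrM; apply: ler_wpM2r => //; apply: gB.
  by rewrite ger0_norm ?subr_ge0// ger0_norm// lerBlDl.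
have le_ta : a + t <= a by rewrite gerDl ltW.
have [c /andP[ac cat] E] := antider_MVT Fg at2 le_ta.
have -> : F (a + t) - F a - t * g a = (g (a + (c - a)) - g a) * t.
  have -> : F (a + t) = F a - g c * (a - (a + t)) by rewrite -E; ring.
  by rewrite [a + (c - a)]addrC subrK; ring.
rewrite normrM; apply: ler_wpM2r => //; apply: gB.
by rewrite ler0_norm ?subr_le0// ltr0_norm// opprB lerBlDl -lerBlDr opprK.
Qed.

Lemma antiderD l F G f g : antider l F f -> antider l G g ->
  antider l (fun t => F t + G t) (fun t => f t + g t).
Proof. by move=> Ff Gg t lt_t; apply: is_deriveD; [exact: Ff|exact: Gg]. Qed.

Lemma antiderZ l F f c : antider l F f ->
  antider l (fun t => c * F t) (fun t => c * f t).
Proof. by move=> Ff t lt_t; apply: is_deriveZ; exact: Ff. Qed.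

Lemma antider_shift l F f c : antider l F f ->
  antider (l - c) (fun t => F (c + t)) (fun t => f (c + t)).
Proof.
move=> Ff t; rewrite ltrBlDl => lt_t.
have dc : is_derive t 1 (fun r : R => c + r) 1.
  have -> : (fun r : R => c + r) = shift c by apply/funext => r /=; rewrite addrC.
  exact: is_derive_shift.
rewrite -[f _]mulr1; exact: (is_derive1_comp (Ff _ lt_t) dc).
Qed.

End antiderivative.

(** * Smoothing by sliding averages along the axes *)

Section averaging.
Context {R : realType} {d : nat}.
Variable eps : R.
Hypotheses (eps_gt0 : 0 < eps) (eps_le1 : eps <= 1).
Local Notation V := 'rV[R]_d.
Implicit Types (v w f g : V -> R) (x y z : V) (i j : 'I_d) (W : seq 'I_d).

(* Sliding averages replace convolution with a mollifier: they are limits of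
   convex combinations of translates, and each one gains a derivative in its
   direction. *)
Definition avg i v x : R :=
  let F := xget (fun=> 0)
    [set F : R -> R | antider (-2) F (fun r => v (x + r *: delta_mx ord0 i))] in
  (F eps - F 0) / eps.

Lemma line_continuous v x i :
  bLip v -> continuous (fun r : R => v (x + r *: delta_mx ord0 i)).
Proof.
move=> /bLip_blip[K [L [K0 L0 [_ vL]]]] r.
apply/cvgrPdist_le => e e0.
apply/nbhs_ballP; exists (e / L); first exact: divr_gt0.
move=> t /=; rewrite ltr_pdivlMr// => /ltW rt.
apply: le_trans (vL _ _) _; apply: le_trans rt; rewrite mulrC.
apply: ler_wpM2r; first exact: ltW.
by rewrite opprD addrACA subrr add0r -scalerBl norm_scale_delta_le.
Qed.

Lemma avg_antider v x i : bLip v ->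
  exists2 F, antider (-2) F (fun r => v (x + r *: delta_mx ord0 i)) &
    avg i v x = (F eps - F 0) / eps.
Proof.
move=> vb; have [F0 F0P] := antider_exists (-2) (@line_continuous v x i vb).
rewrite /avg; set F := xget _ _; exists F => //.
have exP : [set F : R -> R |
  antider (-2) F (fun r => v (x + r *: delta_mx ord0 i))] !=set0 by exists F0.
exact: (xgetPex (fun=> 0) exP).
Qed.

(** Two antiderivatives differ by a constant, so any one that is valid on both sides of 0 may be
    used. The bound [-2] in [avg] leaves room for translating the antiderivative by [t] with
    [|t| <= 1]. *)
Lemma avgE l v x i F : l < 0 -> bLip v ->
  antider l F (fun r => v (x + r *: delta_mx ord0 i)) ->
  avg i v x = (F eps - F 0) / eps.
Proof.
move=> l0 vb FP; have [G GP ->] := avg_antider x i vb.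
congr (_ / _); apply/eqP; rewrite -subr_eq0; apply/eqP.
have N20 : -2 < 0 :> R by rewrite ltrNl oppr0.
have m0 : Num.max (-2) l < 0 by rewrite gt_max N20.
have m2 : -2 <= Num.max (-2) l by rewrite le_max lexx.
have ml : l <= Num.max (-2) l by rewrite le_max lexx orbT.
have GP' := antiderW m2 GP; have FP' := antiderW ml FP.
have [c _] := antider_MVT (antiderD GP' (antiderZ (-1) FP')) m0 (ltW eps_gt0).
move=> E; transitivity (G eps + -1 * F eps - (G 0 + -1 * F 0)); first by ring.
by rewrite E; ring.
Qed.

(** Together with linearity this turns each estimate on averages into a pointwise one: collect all
    terms under a single average, then evaluate at the intermediate point. *)
Lemma avg_mean v x i : bLip v ->
  exists2 c, 0 <= c <= eps & avg i v x = v (x + c *: delta_mx ord0 i).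
Proof.
move=> vb; have [F FP ->] := avg_antider x i vb.
have N20 : -2 < 0 :> R by rewrite ltrNl oppr0.
have [c c0 ->] := antider_MVT FP N20 (ltW eps_gt0).
by exists c => //; rewrite subr0 mulfK// gt_eqF.
Qed.

Lemma avgD v w i : bLip v -> bLip w ->
  avg i (fun x => v x + w x) = fun x => avg i v x + avg i w x.
Proof.
move=> vb wb; apply/funext => x.
have [F FP ->] := avg_antider x i vb; have [G GP ->] := avg_antider x i wb.
have N20 : -2 < 0 :> R by rewrite ltrNl oppr0.
by rewrite (avgE N20 (bLipD vb wb) (antiderD FP GP)); ring.
Qed.

Lemma avgZ v i c : bLip v -> avg i (fun x => c * v x) = fun x => c * avg i v x.
Proof.
move=> vb; apply/funext => x; have [F FP ->] := avg_antider x i vb.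
have N20 : -2 < 0 :> R by rewrite ltrNl oppr0.
by rewrite (avgE N20 (bLipZ c vb) (antiderZ c FP)); ring.
Qed.

Lemma avg_shift v i z : avg i (fun x => v (z + x)) = fun x => avg i v (z + x).
Proof.
apply/funext => x; rewrite /avg.
have -> // : (fun r : R => v (z + (x + r *: delta_mx ord0 i)))
    = (fun r => v (z + x + r *: delta_mx ord0 i)).
by apply/funext => r; rewrite addrA.
Qed.

Lemma avgN v i : bLip v -> avg i (fun x => - v x) = fun x => - avg i v x.
Proof.
move=> vb; under eq_fun do rewrite -mulN1r.
by rewrite avgZ//; apply/funext => x; rewrite mulN1r.
Qed.

Lemma avgB v w i : bLip v -> bLip w ->
  avg i (fun x => v x - w x) = fun x => avg i v x - avg i w x.
Proof. by move=> vb wb; rewrite avgD ?avgN//; exact: bLipN. Qed.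

Lemma avg_mono v w i : bLip v -> bLip w -> (forall x, v x <= w x) ->
  forall x, avg i v x <= avg i w x.
Proof.
move=> vb wb vw x; rewrite -subr_ge0.
have := congr1 (@^~ x) (avgB i wb vb) => /= <-.
have [c _ ->] := avg_mean x i (bLipB wb vb).
by rewrite subr_ge0.
Qed.

Lemma blip_avg K L v i : blip K L v -> blip K L (avg i v).
Proof.
move=> vb; have vbL := blip_bLip vb; split=> [x|x y].
  by have [c _ ->] := avg_mean x i vbL; exact: vb.1.
have -> : avg i v y = avg i (fun z => v (y - x + z)) x.
  by rewrite avg_shift subrK.
have := congr1 (@^~ x) (avgB i vbL (bLip_shift (y - x) vbL)) => /= <-.
have [c _ ->] := avg_mean x i (bLipB vbL (bLip_shift (y - x) vbL)).
apply: le_trans (vb.2 _ _) _.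
by rewrite opprD [- (y - x) + _]addrC addrA subrr add0r opprB.
Qed.

Lemma bLip_avg v i : bLip v -> bLip (avg i v).
Proof. by move=> /bLip_blip[K [L [_ _ /(blip_avg i)/blip_bLip]]]. Qed.

Lemma avg_close K L v i x : 0 <= L -> blip K L v ->
  `|avg i v x - v x| <= L * eps.
Proof.
move=> L0 vb; have [c /andP[c0 ce] ->] := avg_mean x i (blip_bLip vb).
apply: le_trans (vb.2 _ _) _; apply: ler_wpM2l => //.
by rewrite addrAC subrr add0r (le_trans (norm_scale_delta_le _ _))// ger0_norm.
Qed.

(** A partial derivative with a quadratic remainder uniform in [x]. In this form differentiability
    passes through further averages without any exchange of limits. *)
Definition unif_partial (C : R) f i g := forall x (t : R), `|t| <= 1 ->
  `|f (x + t *: delta_mx ord0 i) - f x - t * g x| <= C * t ^+ 2.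

Definition diffq i v x : R := eps^-1 * (v (eps *: delta_mx ord0 i + x) - v x).

(** Fundamental theorem of calculus: moving the window of length [eps] by [t] adds a piece at one
    end and removes one at the other, which leaves the difference quotient of [v] as derivative. *)
Lemma avg_partial K L v i : blip K L v ->
  unif_partial (2 * `|L| / eps) (avg i v) i (diffq i v).
Proof.
move=> vb x t t1; have vbL := blip_bLip vb.
have [F FP ->] := avg_antider x i vbL.
have [t_ge t_le] : -1 <= t /\ t <= 1 by apply/andP; rewrite -ler_norml.
have Ft : antider (-2 - t) (fun r => F (t + r))
    (fun r => v (x + t *: delta_mx ord0 i + r *: delta_mx ord0 i)).
  have -> : (fun r => v (x + t *: delta_mx ord0 i + r *: delta_mx ord0 i))
    = (fun r => v (x + (t + r) *: delta_mx ord0 i)).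
    by apply/funext => r; rewrite scalerDl addrA.
  exact: (antider_shift (c := t) FP).
have lt0 : -2 - t < 0 :> R by lra.
rewrite (avgE lt0 vbL Ft).
have gL a r : `|r| <= `|t| -> `|v (x + (a + r) *: delta_mx ord0 i)
    - v (x + a *: delta_mx ord0 i)| <= `|L| * `|t|.
  move=> rt; apply: le_trans (vb.2 _ _) _; apply: le_trans (ler_norm _) _.
  rewrite normrM normr_id; apply: ler_wpM2l => //.
  rewrite opprD addrACA subrr add0r -scalerBl [a + r]addrC addrK.
  exact: le_trans (norm_scale_delta_le _ _) rt.
have N20 : -2 < 0 :> R by lra.
have et2 : -2 < eps + t by have := eps_gt0; lra.
have t2 : -2 < 0 + t by lra.
have h1 := antider_taylor FP (lt_trans N20 eps_gt0) et2 (gL eps).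
have h2 := antider_taylor FP N20 t2 (gL 0).
rewrite add0r scale0r addr0 in h2.
set e1 := F (eps + t) - F eps - t * v (x + eps *: delta_mx ord0 i) in h1.
set e2 := F t - F 0 - t * v x in h2.
have -> : (F (t + eps) - F (t + 0)) / eps - (F eps - F 0) / eps
    - t * diffq i v x = (e1 - e2) / eps.
  by rewrite /diffq /e1 /e2 addr0 [t + eps]addrC [x + eps *: _]addrC; ring.
rewrite normrM normfV (gtr0_norm eps_gt0) mulrAC ler_pdivlMr// divfK ?gt_eqF//.
apply: le_trans (ler_normB _ _) _; rewrite -[t ^+ 2]real_normK ?num_real//.
by move: (`|L| * `|t| * `|t|) (lerD h1 h2) => q; lra.
Qed.

Lemma avg_unif_partial C f g i j : bLip f -> bLip g ->
  unif_partial C f j g -> unif_partial C (avg i f) j (avg i g).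
Proof.
move=> fb gb fg x t t1; set e := delta_mx ord0 j.
have -> : avg i f (x + t *: e) = avg i (fun y => f (t *: e + y)) x.
  by rewrite avg_shift addrC.
have feb : bLip (fun y => f (t *: e + y)) := bLip_shift _ fb.
have := congr1 (@^~ x) (avgB i feb fb) => /= <-.
have := congr1 (@^~ x) (avgZ i t gb) => /= <-.
have := congr1 (@^~ x) (avgB i (bLipB feb fb) (bLipZ t gb)) => /= <-.
have [c _ ->] := avg_mean x i (bLipB (bLipB feb fb) (bLipZ t gb)).
by rewrite [t *: e + _]addrC; exact: fg.
Qed.

(** Left Riemann sums are convex combinations of translates, the form to which sublinearity and
    translation invariance apply directly. *)
Definition riemann N i v x : R :=
  N%:R^-1 * \sum_(k < N) v (eps * k%:R / N%:R *: delta_mx ord0 i + x).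

Lemma avg_riemann K L v i x N : 0 <= L -> blip K L v ->
  `|avg i v x - riemann N.+1 i v x| <= L / N.+1%:R.
Proof.
move=> L0 vb; have [F FP ->] := avg_antider x i (blip_bLip vb).
have N0 : 0 < N.+1%:R :> R by rewrite ltr0n.
pose tau := eps / N.+1%:R; have tau0 : 0 < tau by apply: divr_gt0.
have -> : F eps - F 0 = \sum_(k < N.+1) (F (tau * k%:R + tau) - F (tau * k%:R)).
  rewrite -(big_mkord xpredT (fun k => F (tau * k%:R + tau) - F (tau * k%:R))).
  rewrite (eq_bigr (fun k => F (tau * k.+1%:R) - F (tau * k%:R))); last first.
    by move=> k _; rewrite -[k.+1]addn1 natrD mulrDr mulr1.
  rewrite (telescope_sumr (fun k => F (tau * k%:R)))//.
  by rewrite mulr0 /tau divfK// gt_eqF.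
have -> : (\sum_(k < N.+1) (F (tau * k%:R + tau) - F (tau * k%:R))) / eps
    - riemann N.+1 i v x
  = \sum_(k < N.+1) (F (tau * k%:R + tau) - F (tau * k%:R)
      - tau * v (x + (tau * k%:R) *: delta_mx ord0 i)) / eps.
  rewrite /riemann mulr_suml mulr_sumr -sumrB; apply: eq_bigr => k _.
  rewrite [x + _]addrC.
  have -> : eps * k%:R / N.+1%:R = tau * k%:R by rewrite /tau; ring.
  by rewrite /tau; field; rewrite !gt_eqF.
apply: le_trans (ler_norm_sum _ _ _) _.
have kB (k : 'I_N.+1) : `|(F (tau * k%:R + tau) - F (tau * k%:R)
      - tau * v (x + (tau * k%:R) *: delta_mx ord0 i)) / eps|
    <= L * tau * tau / eps.
  have k0 : 0 <= tau * k%:R by rewrite mulr_ge0// ltW.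
  rewrite normrM normfV (gtr0_norm eps_gt0) ler_pM2r ?invr_gt0//.
  rewrite [leRHS](_ : _ = L * tau * `|tau|); last by rewrite gtr0_norm.
  apply: (antider_taylor FP); [by lra|by lra|].
  move=> r; rewrite (gtr0_norm tau0) => rt.
  apply: le_trans (vb.2 _ _) _; apply: ler_wpM2l => //.
  rewrite opprD addrACA subrr add0r -scalerBl [_ + r]addrC addrK.
  exact: le_trans (norm_scale_delta_le _ _) rt.
apply: le_trans (ler_sum _ (fun k _ => kB k)) _.
rewrite sumr_const card_ord -[leLHS]mulr_natr.
have -> : L * tau * tau / eps * N.+1%:R = eps * (L / N.+1%:R).
  by rewrite /tau; field; rewrite !gt_eqF.
by rewrite ler_piMl// divr_ge0// ltW.
Qed.

Definition avgs W v : V -> R := foldr avg v W.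

Lemma blip_avgs K L v W : blip K L v -> blip K L (avgs W v).
Proof. by move=> vb; elim: W => //= i W; exact: blip_avg. Qed.

Lemma bLip_avgs v W : bLip v -> bLip (avgs W v).
Proof. by move=> vb; elim: W => //= i W; exact: bLip_avg. Qed.

Lemma avgsD v w W : bLip v -> bLip w ->
  avgs W (fun x => v x + w x) = fun x => avgs W v x + avgs W w x.
Proof.
by move=> vb wb; elim: W => //= i W ->; rewrite avgD//; exact: bLip_avgs.
Qed.

Lemma avgsZ v W c : bLip v -> avgs W (fun x => c * v x) = fun x => c * avgs W v x.
Proof. by move=> vb; elim: W => //= i W ->; rewrite avgZ//; exact: bLip_avgs. Qed.

Lemma avgsB v w W : bLip v -> bLip w ->
  avgs W (fun x => v x - w x) = fun x => avgs W v x - avgs W w x.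
Proof.
by move=> vb wb; elim: W => //= i W ->; rewrite avgB//; exact: bLip_avgs.
Qed.

Lemma avgs_shift v W z : avgs W (fun x => v (z + x)) = fun x => avgs W v (z + x).
Proof. by elim: W => //= i W ->; rewrite avg_shift. Qed.

Lemma avgs_close K L v W x : 0 <= L -> blip K L v ->
  `|avgs W v x - v x| <= L * eps * (size W)%:R.
Proof.
move=> L0 vb; elim: W x => [|i W ih] x /=; first by rewrite subrr normr0 mulr0.
rewrite -(subrKA (avgs W v x)); apply: le_trans (ler_normD _ _) _.
rewrite -[(size W).+1]add1n natrD mulrDr mulr1; apply: lerD => //.
exact: avg_close L0 (blip_avgs W vb).
Qed.

(** Each average displaces the evaluation point by at most [eps]. Smallness on a large ball thus
    survives mollification on a slightly smaller one. *)
Lemma avgs_local v W x B : bLip v ->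
  (forall y, `|y - x| <= eps * (size W)%:R -> `|v y| <= B) ->
  `|avgs W v x| <= B.
Proof.
move=> vb; elim: W x => [|i W ih] x /= vB.
  by apply: vB; rewrite subrr normr0 mulr0.
have [c /andP[c0 ce] ->] := avg_mean x i (bLip_avgs W vb).
apply: ih => y yx; apply: vB.
rewrite -(subrKA (x + c *: delta_mx ord0 i)); apply: le_trans (ler_normD _ _) _.
rewrite -[(size W).+1]addn1 natrD mulrDr mulr1; apply: lerD => //.
rewrite addrAC subrr add0r.
by apply: le_trans (norm_scale_delta_le _ _) _; rewrite ger0_norm.
Qed.

Lemma blip_diffq K L v i : blip K L v ->
  blip (2 * K / eps) (2 * L / eps) (diffq i v).
Proof.
move=> vb; have e0 : 0 < eps^-1 by rewrite invr_gt0.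
have := blipZ eps^-1 (blipD (blip_shift (eps *: delta_mx ord0 i) vb) (blipN vb)).
rewrite (gtr0_norm e0); suff cE (q : R) : 2 * q / eps = eps^-1 * (q + q).
  by rewrite !cE.
by ring.
Qed.

Lemma bLip_diffq v i : bLip v -> bLip (diffq i v).
Proof. by move=> /bLip_blip[K [L [_ _ /(blip_diffq i)/blip_bLip]]]. Qed.

Lemma diffq_avgs v W i : bLip v -> diffq i (avgs W v) = avgs W (diffq i v).
Proof.
move=> vb; have vsb : bLip (fun x => v (eps *: delta_mx ord0 i + x)).
  exact: bLip_shift.
by rewrite /diffq avgsZ ?avgsB ?avgs_shift//; exact: bLipB.
Qed.

(** Differentiation in direction [i] consumes one average in that direction, hence [rem i W]; the
    other averages pass through. *)
Lemma avgs_partial K L v W i : blip K L v -> i \in W ->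
  unif_partial (2 * `|L| / eps) (avgs W v) i (avgs (rem i W) (diffq i v)).
Proof.
move=> vb; have vbL := blip_bLip vb; elim: W => //= j W ih.
rewrite inE; case: eqVneq => [-> _|ji /= iW].
  rewrite -diffq_avgs//; exact: avg_partial (blip_avgs W vb).
apply: avg_unif_partial; [exact: bLip_avgs| |exact: ih].
by apply: bLip_avgs; exact: bLip_diffq.
Qed.

End averaging.

(** * From uniform remainders to derivatives, and from [Cb3] to Lipschitz bounds *)

Section partials.
Context {R : realType} {d : nat}.
Local Notation V := 'rV[R]_d.
Implicit Types (f g : V -> R) (x y z : V) (i j : 'I_d).

Lemma unif_partial_derive C f i g x : unif_partial C f i g ->
  is_derive x (delta_mx ord0 i) f (g x).
Proof.
move=> fg.
suff cvg_g : h^-1 *: (f (h *: delta_mx ord0 i + x) - f x) @[h --> 0^'] --> g x.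
  by apply: DeriveDef; [exact: cvgP cvg_g|exact: cvg_lim cvg_g].
apply/cvgrPdist_le => e e0.
have C0 : 0 < `|C| + 1 by rewrite ltr_wpDl.
near=> h.
have h0 : h != 0 by near: h; exact: nbhs_dnbhs_neq.
have h1 : `|h| <= 1.
  by near: h; apply: dnbhs0_le.
have he : `|h| <= e / (`|C| + 1) by near: h; apply: dnbhs0_le; exact: divr_gt0.
have := fg x h h1; rewrite [x + _]addrC; set D := f _ - f x => DC.
have -> : g x - h^-1 *: D = - (h^-1 * (D - h * g x)).
  by rewrite /GRing.scale/=; field.
rewrite normrN normrM normfV ler_pdivrMl ?normr_gt0//.
apply: le_trans DC _; rewrite -real_normK ?num_real// expr2 mulrA mulrC.
apply: ler_wpM2l => //; move: he; rewrite ler_pdivlMr// => he.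
apply: le_trans he; rewrite mulrC; apply: ler_wpM2l => //.
by rewrite (le_trans (ler_norm C))// lerDl.
Unshelve. all: by end_near. Qed.

Lemma line_derive f i z r : derivable f (z + r *: delta_mx ord0 i) (delta_mx ord0 i) ->
  is_derive r 1 (fun r : R => f (z + r *: delta_mx ord0 i))
    ('D_(delta_mx ord0 i) f (z + r *: delta_mx ord0 i)).
Proof.
set e := delta_mx ord0 i => df.
have E : (fun h : R => h^-1 *: (f (z + (h *: (1 : R) + r) *: e) - f (z + r *: e)))
    = (fun h => h^-1 *: (f (h *: e + (z + r *: e)) - f (z + r *: e))).
  apply/funext => h; congr (_ *: (f _ - _)).
  by rewrite [h *: (1 : R)]mulr1 scalerDl addrCA.
by apply: DeriveDef; rewrite /derivable /derive /= E.
Qed.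

Lemma Cb3_bLip f : Cb3 f -> bLip f.
Proof.
move=> fC; have [fd _ [K fK]] := fC [::] isT.
have /choice[M fM] : forall i, exists M : R, forall x, `|partial f i x| <= M.
  by move=> i; have [_ _ [M fM]] := fC [:: i] isT; exists M.
pose B := \sum_i `|M i|.
have MB i : `|M i| <= B by rewrite /B (bigD1 i)//= lerDl sumr_ge0.
have fB i x : `|partial f i x| <= B.
  by rewrite (le_trans (fM _ _))// (le_trans (ler_norm _)).
have B0 : 0 <= B by rewrite sumr_ge0.
split; first by exists K.
exists (d%:R * (3 * B)) => x y.
have -> : f x - f y = f (y + (x - y)) - f y - \sum_i (x - y) ord0 i * 0.
  by rewrite big1 ?subr0 => [|i _]; rewrite ?mulr0// [y + _]addrC subrK.
(* With zero slopes only axis increments remain. Each is at most [2 * B * |t|] for the Taylor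
   remainder plus [B * |t|] for the linear term, whence the factor 3. *)
rewrite -mulrA; apply: (coord_telescope (c := fun=> 0)) => i z t _ ty.
rewrite mulr0 subr0.
set w := y + z; apply: (@le_trans _ _ (3 * B * `|t|)); last first.
  by apply: ler_wpM2l => //; rewrite mulr_ge0.
have FP : antider (- (`|t| + 1)) (fun r => f (w + r *: delta_mx ord0 i))
    (fun r => partial f i (w + r *: delta_mx ord0 i)).
  by move=> r _; apply: line_derive; exact: fd.
have tN := ler_norm (- t); rewrite normrN in tN.
have l0 : - (`|t| + 1) < 0 by rewrite oppr_lt0 ltr_wpDl.
have lt : - (`|t| + 1) < 0 + t by lra.
have := antider_taylor (B := 2 * B) FP l0 lt.
rewrite add0r scale0r addr0; set D := f _ - f w; set p0 := partial f i w => H.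
have {}H : `|D - t * p0| <= 2 * B * `|t|.
  apply: H => r _; apply: le_trans (ler_normB _ _) _.
  by rewrite mulr_natl mulr2n; apply: lerD; exact: fB.
rewrite -[D](subrK (t * p0)); apply: le_trans (ler_normD _ _) _.
have tp : `|t * p0| <= B * `|t| by rewrite normrM mulrC; apply: ler_wpM2r => //; exact: fB.
apply: le_trans (lerD H tp) _; lra.
Qed.

Lemma coord_derive (g : R -> R) (dg : R) i j x : is_derive (x ord0 i) 1 g dg ->
  is_derive x (delta_mx ord0 j) (fun y : V => g (y ord0 i))
    (if j == i then dg else 0).
Proof.
move=> [gd gE]; case: eqVneq => [->|ji].
  have E : (fun h : R => h^-1 *:
      (g ((h *: delta_mx ord0 i + x) ord0 i) - g (x ord0 i)))
    = (fun h => h^-1 *: (g (h *: (1 : R) + x ord0 i) - g (x ord0 i))).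
    by apply/funext => h; rewrite !mxE !eqxx.
  by apply: DeriveDef; rewrite /derivable /derive /= E.
have E : (fun h : R => h^-1 *:
    (g ((h *: delta_mx ord0 j + x) ord0 i) - g (x ord0 i))) = cst 0.
  apply/funext => h; rewrite !mxE eqxx/= [i == j]eq_sym (negbTE ji).
  by rewrite mulr0 add0r subrr scaler0.
apply: DeriveDef; rewrite /derivable /derive /= E; first exact: is_cvg_cst.
exact: lim_cst.
Qed.

End partials.

(** * Functions of one variable with bounded derivatives *)

Section smooth_line.
Context {R : realType}.
Implicit Types (f g : R -> R) (n : nat).

(** Derivatives are carried as witnesses, so closure under sums and products is an induction on
    [n]. *)
Fixpoint smoothb n f : Prop :=
  [/\ continuous f, (exists M : R, forall t, `|f t| <= M)
    & if n is m.+1 then exists2 f', forall t : R, is_derive t 1 f (f' t) & smoothb m f'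
      else True].

Lemma smoothb_cst n c : smoothb n (fun=> c).
Proof.
elim: n c => [|n ih] c; split=> //; first by move=> t; exact: cvg_cst.
- by exists `|c|.
- by move=> t; exact: cvg_cst.
- by exists `|c|.
- by exists (fun=> 0) => // t; exact: is_derive_cst.
Qed.

Lemma smoothbW n f : smoothb n.+1 f -> smoothb n f.
Proof.
elim: n f => [|n ih] f [fc fM [f' ff' f'b]]; split=> //.
by exists f' => //; exact: ih.
Qed.

Lemma smoothbD n f g : smoothb n f -> smoothb n g ->
  smoothb n (fun t => f t + g t).
Proof.
elim: n f g => [|n ih] f g [fc [M fM] fd] [gc [N gN] gd]; split.
- by move=> t; apply: cvgD; [exact: fc|exact: gc].
- by exists (M + N) => t; apply: le_trans (ler_normD _ _) _; apply: lerD.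
- by [].
- by move=> t; apply: cvgD; [exact: fc|exact: gc].
- by exists (M + N) => t; apply: le_trans (ler_normD _ _) _; apply: lerD.
case: fd => f' ff' f's; case: gd => g' gg' g's.
exists (fun t => f' t + g' t); last exact: ih.
by move=> t; exact: is_deriveD.
Qed.

Lemma smoothbM n f g : smoothb n f -> smoothb n g ->
  smoothb n (fun t => f t * g t).
Proof.
have bM f' g' : (exists M : R, forall t, `|f' t| <= M) ->
    (exists M : R, forall t, `|g' t| <= M) ->
    exists M : R, forall t : R, `|f' t * g' t| <= M.
  move=> [M fM] [N gN]; exists (M * N) => t.
  by rewrite normrM; apply: ler_pM.
elim: n f g => [|n ih] f g fs gs.
  case: (fs) => fc fb _; case: (gs) => gc gb _; split=> //; last exact: bM.
  by move=> t; apply: cvgM; [exact: fc|exact: gc].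
case: (fs) => fc fb [f' ff' f's]; case: (gs) => gc gb [g' gg' g's].
split; [by move=> t; apply: cvgM; [exact: fc|exact: gc]|exact: bM|].
exists (fun t => f t * g' t + g t * f' t).
  by move=> t; exact: is_deriveM.
by apply: smoothbD; apply: ih => //; exact: smoothbW.
Qed.

Lemma smoothbZ n f c : smoothb n f -> smoothb n (fun t => c * f t).
Proof. by apply: smoothbM; exact: smoothb_cst. Qed.

(* The derivatives of [qbump] and [pbump] are polynomials in the two functions,
   so both have bounded derivatives of every order. *)
Definition qbump (t : R) : R := (1 + t ^+ 2)^-1.
Definition pbump (t : R) : R := t * qbump t.

Lemma qbump_den (t : R) : 0 < 1 + t ^+ 2.
Proof. by rewrite ltr_pwDl// sqr_ge0. Qed.

Lemma qbump_ge0 t : 0 <= qbump t.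
Proof. by rewrite invr_ge0 ltW// qbump_den. Qed.

Lemma qbump_le1 t : qbump t <= 1.
Proof. by rewrite invf_le1 ?qbump_den// lerDl sqr_ge0. Qed.

Lemma pbump_le1 t : `|pbump t| <= 1.
Proof.
have t0 := qbump_den t.
rewrite normrM [`|qbump t|]ger0_norm ?qbump_ge0// ler_pdivrMr// mul1r.
have := sqr_ge0 (`|t| - 1); rewrite -[t ^+ 2]real_normK ?num_real//.
by have := normr_ge0 t; nra.
Qed.

Lemma qbump_derive (t : R) : is_derive t 1 qbump (-2 * (pbump t * qbump t)).
Proof.
have t0 := qbump_den t.
have dd : is_derive t 1 (fun t : R => 1 + t ^+ 2) (2 * t).
  have := is_deriveD (is_derive_cst (1 : R) t (1 : R))
    (is_deriveX 2 (is_derive_id t (1 : R))).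
  by rewrite /GRing.scale/= add0r expr1 mulr1.
apply: (is_derive_eq
  (@is_deriveV R (fun t : R => 1 + t ^+ 2) t (2 * t) 1 (lt0r_neq0 t0) dd)).
by rewrite /GRing.scale/= /pbump /qbump; field; rewrite gt_eqF.
Qed.

Lemma pbump_derive (t : R) : is_derive t 1 pbump (qbump t + -2 * (pbump t * pbump t)).
Proof.
have t0 := qbump_den t.
apply: (is_derive_eq (is_deriveM (is_derive_id t (1 : R)) (qbump_derive t))).
by rewrite /GRing.scale/= /pbump /qbump; field; rewrite gt_eqF.
Qed.

Lemma smoothb_pqbump n : smoothb n pbump /\ smoothb n qbump.
Proof.
have cd f f' : (forall t : R, is_derive t 1 f (f' t)) -> continuous f.
  move=> ff' t; apply: differentiable_continuous; apply/derivable1_diffP.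
  by case: (ff' t).
have pc := cd _ _ pbump_derive; have qc := cd _ _ qbump_derive.
have pM : exists M : R, forall t, `|pbump t| <= M.
  by exists 1 => t; exact: pbump_le1.
have qM : exists M : R, forall t, `|qbump t| <= M.
  by exists 1 => t; rewrite ger0_norm ?qbump_ge0 ?qbump_le1.
elim: n => [//|n [ps qs]]; split; split=> //.
  exists (fun t => qbump t + -2 * (pbump t * pbump t)); first exact: pbump_derive.
  by apply: smoothbD => //; apply: smoothbZ; exact: smoothbM.
exists (fun t => -2 * (pbump t * qbump t)); first exact: qbump_derive.
by apply: smoothbZ; exact: smoothbM.
Qed.

End smooth_line.

(** * Two sources of [Cb3] functions: functions of one coordinate and repeated averages *)

Section Cb3_examples.
Context {R : realType} {d : nat}.
Local Notation V := 'rV[R]_d.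

Lemma smoothb_iter_partial n (g : R -> R) (i : 'I_d) (s : seq 'I_d) :
  smoothb n g -> (size s <= n)%N ->
  exists2 g', iter_partial (fun y : V => g (y ord0 i)) s = (fun y => g' (y ord0 i))
    & smoothb (n - size s) g'.
Proof.
move=> gs; elim: s => [|j s ih] /= sn; first by exists g => //; rewrite subn0.
have [g' -> ] := ih (ltnW sn).
rewrite -subnSK//= => -[_ _ [h g'h hs]].
exists (if j == i then h else (fun=> 0)); last first.
  by case: ifP => _ //; exact: smoothb_cst.
apply/funext => x; rewrite /partial.
have [_ ->] := coord_derive j (g'h (x ord0 i)).
by case: ifP.
Qed.

Lemma smoothb_Cb3 (g : R -> R) (i : 'I_d) :
  smoothb 3 g -> Cb3 (fun y : V => g (y ord0 i)).
Proof.
move=> gs s s3; have [g' -> ] := smoothb_iter_partial i gs s3.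
case: (3 - size s)%N (subn_gt0 (size s) 3) => [|n].
  rewrite ltnn => /esym/negbT; rewrite -leqNgt => s3' [g'c [M g'M] _]; split.
  - by rewrite ltnNge s3'.
  - move=> x; apply: (@continuous_comp _ _ _ (fun y : V => y ord0 i) g').
      exact: coord_continuous.
    exact: g'c.
  - by exists M.
move=> _ [g'c [M g'M] [h g'h _]]; split.
- by move=> _ j x; have [] := coord_derive j (g'h (x ord0 i)).
- move=> x; apply: (@continuous_comp _ _ _ (fun y : V => y ord0 i) g').
    exact: coord_continuous.
  exact: g'c.
- by exists M.
Qed.

Variable eps : R.
Hypothesis eps_gt0 : 0 < eps.

(** Each direction occurs three times because every derivative uses up one occurrence; this covers
    third order derivatives, also repeated ones in one direction. *)
Definition word3 : seq 'I_d := enum 'I_d ++ enum 'I_d ++ enum 'I_d.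

Lemma count_word3 i : count_mem i word3 = 3%N.
Proof. by rewrite !count_cat !count_uniq_mem ?enum_uniq// mem_enum. Qed.

Definition rems (W s : seq 'I_d) := foldr (fun i W => rem i W) W s.

Lemma count_rems W s i :
  count_mem i (rems W s) = (count_mem i W - count_mem i s)%N.
Proof.
elim: s => [|j s ih] /=; first by rewrite subn0.
by rewrite count_mem_rem ih subnAC -subnDA addnC.
Qed.

Lemma iter_partial_avgs (v : V -> R) W s : bLip v ->
  (forall i, (count_mem i s <= count_mem i W)%N) ->
  iter_partial (avgs eps W v) s = avgs eps (rems W s) (foldr (diffq eps) v s).
Proof.
move=> vb; elim: s => //= i s ih cnt.
have cnt' j : (count_mem j s <= count_mem j W)%N.
  by apply: leq_trans (cnt j); rewrite leq_addl.
have sb : bLip (foldr (diffq eps) v s).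
  by elim: (s) => //= j s' ihs; exact: bLip_diffq.
rewrite ih//; apply/funext => x; rewrite /partial.
have iW : i \in rems W s.
  rewrite -has_pred1 has_count count_rems subn_gt0.
  by have := cnt i; rewrite eqxx add1n.
have [K [L [_ _ sKL]]] := bLip_blip sb.
by have [_ ->] := unif_partial_derive x (avgs_partial eps_gt0 sKL iW).
Qed.

Lemma Cb3_avgs (v : V -> R) : bLip v -> Cb3 (avgs eps word3 v).
Proof.
move=> vb s s3.
have cnt i : (count_mem i s <= count_mem i word3)%N.
  by rewrite count_word3; apply: leq_trans s3; exact: count_size.
have sb : bLip (foldr (diffq eps) v s).
  by elim: (s) => //= j s' ihs; exact: bLip_diffq.
have [K [L [_ _ sKL]]] := bLip_blip sb.
rewrite iter_partial_avgs//.
have aKL := blip_avgs eps_gt0 (rems word3 s) sKL.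
split; [|exact: blip_continuous aKL|by exists K; exact: aKL.1].
move=> s3' i x.
have iW : i \in rems word3 s.
  rewrite -has_pred1 has_count count_rems subn_gt0 count_word3.
  by apply: leq_ltn_trans s3'; exact: count_size.
by have [] := unif_partial_derive x (avgs_partial eps_gt0 sKL iW).
Qed.

End Cb3_examples.

Lemma ler_inv_natP (R : realType) (a b C : R) :
  (forall N : nat, a <= b + C / N.+1%:R) -> a <= b.
Proof.
move=> ab; apply/ler_addgt0Pr => e e0; apply: le_trans (ab (Num.bound (`|C| / e))) _.
rewrite lerD2l ler_pdivrMr ?ltr0n//.
have := archi_boundP (divr_ge0 (normr_ge0 C) (ltW e0)).
rewrite ltr_pdivrMr// mulrC => /ltW h.
apply: le_trans (ler_norm C) _; apply: le_trans h _.
by apply: ler_wpM2l; [exact: ltW|rewrite ler_nat].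
Qed.

(** * One step of the scheme and Jensen's inequality for averages *)

Section sublinear_step.
Context {R : realType} {d : nat}.
Local Notation V := 'rV[R]_d.
Implicit Types (v w : V -> R) (x y z : V).

Definition sublinear_law (e : (V -> R) -> R) :=
  [/\ forall v w, bLip v -> bLip w -> (forall y, v y <= w y) -> e v <= e w,
      forall c, e (fun=> c) = c,
      forall v w, bLip v -> bLip w -> e (fun y => v y + w y) <= e v + e w
    & forall c v, bLip v -> 0 <= c -> e (fun y => c * v y) = c * e v].

Definition step (e : (V -> R) -> R) (a : R) v x : R := e (fun y => v (x + a *: y)).

Variables (e : (V -> R) -> R) (a : R).
Hypothesis e_sub : sublinear_law e.
Local Notation T := (step e a).

Lemma step_mono v w : bLip v -> bLip w -> (forall x, v x <= w x) ->
  forall x, T v x <= T w x.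
Proof.
by case: e_sub => mono _ _ _ vb wb vw x; apply: mono => //; exact: bLip_affine.
Qed.

Lemma step_cst c x : T (fun=> c) x = c.
Proof. by case: e_sub => _ ecst _ _; exact: ecst. Qed.

Lemma stepD v w x : bLip v -> bLip w ->
  T (fun y => v y + w y) x <= T v x + T w x.
Proof.
by case: e_sub => _ _ add _ vb wb; apply: add; exact: bLip_affine.
Qed.

Lemma stepZ c v x : bLip v -> 0 <= c -> T (fun y => c * v y) x = c * T v x.
Proof.
by case: e_sub => _ _ _ hom vb c0; apply: hom => //; exact: bLip_affine.
Qed.

Lemma step_addc v c x : bLip v -> T (fun y => v y + c) x = T v x + c.
Proof.
move=> vb; apply/eqP; rewrite eq_le; apply/andP; split.
  by apply: le_trans (stepD _ vb (bLip_cst c)) _; rewrite step_cst.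
have vcb : bLip (fun y => v y + c) by apply: bLipD => //; exact: bLip_cst.
have := stepD x vcb (bLip_cst (- c)); rewrite step_cst.
have -> : (fun y => v y + c + - c) = v by apply/funext => y; rewrite addrK.
by rewrite lerBrDr.
Qed.

Lemma step_shift v z : T (fun y => v (z + y)) = fun x => T v (z + x).
Proof.
by apply/funext => x; rewrite /step; congr e; apply/funext => y; rewrite addrA.
Qed.

Lemma step_leD v w c : bLip v -> bLip w -> (forall x, v x <= w x + c) ->
  forall x, T v x <= T w x + c.
Proof.
move=> vb wb vw x; rewrite -step_addc//.
by apply: step_mono => //; apply: bLipD => //; exact: bLip_cst.
Qed.

Lemma step_subadd v w x : bLip v -> bLip w ->
  T v x - T w x <= T (fun y => v y - w y) x.
Proof.
move=> vb wb; rewrite lerBlDr; apply: le_trans (stepD _ (bLipB vb wb) wb).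
by under [X in _ <= T X _]eq_fun do rewrite subrK.
Qed.

Lemma step_dist v w B : bLip v -> bLip w -> (forall x, `|v x - w x| <= B) ->
  forall x, `|T v x - T w x| <= B.
Proof.
move=> vb wb vw x; rewrite ler_norml; apply/andP; split.
  rewrite lerBrDr addrC lerBlDr; apply: step_leD => // y.
  by have := vw y; rewrite ler_norml => /andP[+ _]; lra.
rewrite lerBlDl; apply: step_leD => // y.
by have := vw y; rewrite ler_norml => /andP[_]; lra.
Qed.

Lemma blip_step K L v : blip K L v -> blip K L (T v).
Proof.
move=> vb; have vbL := blip_bLip vb; split=> [x|x y].
  have := step_dist vbL (bLip_cst 0) (B := K) _ x; rewrite step_cst subr0.
  by apply=> z; rewrite subr0; exact: vb.1.
have -> : T v x = T (fun z => v (x - y + z)) y by rewrite step_shift subrK.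
apply: step_dist => //; first exact: bLip_shift.
by move=> z; apply: le_trans (vb.2 _ _) _; rewrite addrK.
Qed.

Lemma bLip_step v : bLip v -> bLip (T v).
Proof. by move=> /bLip_blip[K [L [_ _ /blip_step/blip_bLip]]]. Qed.

Lemma step_sum (I : Type) (r : seq I) (F : I -> V -> R) x :
  (forall i, bLip (F i)) ->
  T (fun y => \sum_(i <- r) F i y) x <= \sum_(i <- r) T (F i) x.
Proof.
move=> Fb; elim: r => [|i r ih].
  under [X in T X]eq_fun do rewrite big_nil.
  by rewrite big_nil step_cst.
under [X in T X]eq_fun do rewrite big_cons.
rewrite big_cons; apply: le_trans (stepD _ _ _) _ => //; first exact: bLip_sum.
by rewrite lerD2l.
Qed.

Lemma blip_iter_step n K L v : blip K L v -> blip K L (iter n T v).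
Proof. by move=> vb; elim: n => //= n; exact: blip_step. Qed.

Variable eps : R.
Hypotheses (eps_gt0 : 0 < eps) (eps_le1 : eps <= 1).

Lemma step_riemann N i v x : bLip v ->
  T (riemann eps N i v) x <= riemann eps N i (T v) x.
Proof.
move=> vb; have Fb (k : 'I_N) :
    bLip (fun y => v (eps * k%:R / N%:R *: delta_mx ord0 i + y)).
  exact: bLip_shift.
rewrite /riemann stepZ ?invr_ge0//; last exact: bLip_sum.
apply: ler_wpM2l; first by rewrite invr_ge0.
apply: le_trans (step_sum _ _ _) _ => //; apply: ler_sum => k _.
by rewrite step_shift.
Qed.

Lemma step_avg i v x : bLip v -> T (avg eps i v) x <= avg eps i (T v) x.
Proof.
move=> vb; have [K [L [_ /ltW L0 vKL]]] := bLip_blip vb.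
(* One error [L / N.+1] replaces the average by a Riemann sum inside [T], a second one returns to
   the average outside. *)
apply: (@ler_inv_natP _ _ _ (2 * L)) => N.
have rb : bLip (riemann eps N.+1 i v).
  by apply/bLipZ/bLip_sum => k; exact: bLip_shift.
apply: (@le_trans _ _ (T (riemann eps N.+1 i v) x + L / N.+1%:R)).
  apply: step_leD => // [|y]; first exact: bLip_avg.
  have := avg_riemann eps_gt0 eps_le1 i y N L0 vKL.
  by rewrite ler_norml => /andP[_]; rewrite lerBlDl.
have := avg_riemann eps_gt0 eps_le1 i x N L0 (blip_step vKL).
rewrite ler_norml -mulrA; move: (L / _) (step_riemann N.+1 i x vb) => c.
by move=> ? /andP[? _]; lra.
Qed.

Lemma step_avgs W v x : bLip v -> T (avgs eps W v) x <= avgs eps W (T v) x.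
Proof.
move=> vb; elim: W x => //= i W ih x.
apply: le_trans (step_avg _ _ _) _; first exact: bLip_avgs.
apply: avg_mono => //.
  by apply: bLip_step; exact: bLip_avgs.
by apply: bLip_avgs => //; exact: bLip_step.
Qed.

End sublinear_step.

(** * A majorant built from coordinate tests *)

Section majorant.
Context {R : realType} {d : nat}.
Local Notation V := 'rV[R]_d.

(** A smooth substitute for the minimum of 1 and [t ^+ 2], which is at most [2 * chi t]. *)
Definition chi (t : R) : R := 1 - qbump t.

Lemma chiE t : chi t = t ^+ 2 / (1 + t ^+ 2).
Proof. by rewrite /chi /qbump; field; rewrite gt_eqF// qbump_den. Qed.

Lemma chi_ge0 t : 0 <= chi t.
Proof. by rewrite subr_ge0 qbump_le1. Qed.

Lemma chi_ge_sqr t : `|t| <= 1 -> t ^+ 2 <= 2 * chi t.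
Proof.
move=> t1; rewrite chiE mulrA ler_pdivlMr ?qbump_den//.
have : t ^+ 2 <= 1 by rewrite -real_normK ?num_real// exprn_ile1.
by have := sqr_ge0 t; nra.
Qed.

Lemma chi_ge_half t : 1 <= `|t| -> 1 <= 2 * chi t.
Proof.
move=> t1; rewrite chiE mulrA ler_pdivlMr ?qbump_den//.
have : 1 <= t ^+ 2 by rewrite -real_normK ?num_real// exprn_ege1.
lra.
Qed.

Lemma pbump_close (t : R) : `|t - pbump t| <= t ^+ 2.
Proof.
have t0 := qbump_den t.
have -> : t - pbump t = t ^+ 2 * pbump t.
  by rewrite /pbump /qbump; field; rewrite gt_eqF.
rewrite normrM [`|t ^+ 2|]ger0_norm ?sqr_ge0// ler_piMr ?sqr_ge0//.
exact: pbump_le1.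
Qed.

(** The radii [rho] and [rho^-1] cut out three regions, where the error is of order [|y| ^+ 2],
    [rho ^+ 2] and 1. All [chi] terms are nonnegative, so the coordinate that attains the norm can
    pay the whole error. The bracket in [c] dominates the constants of the three regions; the factor
    2 in front comes from the lower bounds on [chi]. *)
Lemma taylor_majorant (f : V -> R) (f' : 'I_d -> V -> R) (K B D rho : R) :
  0 < rho <= 1 -> 0 <= K -> 0 <= B -> 0 <= D ->
  (forall i, unif_partial B f i (f' i)) ->
  (forall i x y, `|f' i x - f' i y| <= B * `|x - y|) ->
  (forall i, `|f' i 0| <= D * rho ^+ 2) ->
  (forall y, `|f y| <= K) ->
  (forall y, `|y| <= rho^-1 -> `|f y| <= rho ^+ 2) ->
  let c := 2 * (2 * K + 2 + d%:R * (2 * B + 2 * D)) in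
  forall y, f y - f 0 <= \sum_i (f' i 0 * pbump (y ord0 i)
    + (c * rho ^+ 2 * chi ((rho^-1 *: y) ord0 i) + c * chi ((rho *: y) ord0 i))).
Proof.
move=> /andP[rho0 rho1] K0 B0 D0 fd f'L f'D fK frho c y.
have d0 : 0 <= d%:R :> R by [].
have rr0 : 0 <= rho ^+ 2 by exact: sqr_ge0.
have rr1 : rho ^+ 2 <= 1 by rewrite exprn_ile1// ltW.
have dB : 0 <= d%:R * B by exact: mulr_ge0.
have dD : 0 <= d%:R * D by exact: mulr_ge0.
have c0 : 0 <= c by rewrite /c; nra.
rewrite big_split/= -lerBlDl.
set S := \sum_i f' i 0 * pbump (y ord0 i); set X := f y - f 0 - S.
have f'D1 i : `|f' i 0| <= D.
  by rewrite (le_trans (f'D i))// ler_piMr.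
have S_le (q : R) : (forall i, `|f' i 0| <= q) -> `|S| <= d%:R * q.
  move=> f'q; apply: le_trans (ler_norm_sum _ _ _) _.
  rewrite -[d in d%:R]card_ord -sum1_card natr_sum mulr_suml.
  apply: ler_sum => i _; rewrite mul1r normrM.
  by rewrite (le_trans _ (f'q i))// ler_piMr// pbump_le1.
have t1_ge0 i : 0 <= c * rho ^+ 2 * chi ((rho^-1 *: y) ord0 i).
  by apply: mulr_ge0; [exact: mulr_ge0|exact: chi_ge0].
have t2_ge0 i : 0 <= c * chi ((rho *: y) ord0 i).
  by apply: mulr_ge0; [exact: c0|exact: chi_ge0].
have pick1 i q : X <= q -> q <= c * rho ^+ 2 * chi ((rho^-1 *: y) ord0 i) ->
    X <= \sum_i (c * rho ^+ 2 * chi ((rho^-1 *: y) ord0 i)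
                 + c * chi ((rho *: y) ord0 i)).
  move=> Xq qi; rewrite (bigD1 i)//= (le_trans Xq)// (le_trans qi)//.
  rewrite -addrA lerDl addr_ge0// sumr_ge0// => j _.
  by rewrite addr_ge0.
have pick2 i q : X <= q -> q <= c * chi ((rho *: y) ord0 i) ->
    X <= \sum_i (c * rho ^+ 2 * chi ((rho^-1 *: y) ord0 i)
                 + c * chi ((rho *: y) ord0 i)).
  move=> Xq qi; rewrite (bigD1 i)//= (le_trans Xq)// (le_trans qi)//.
  rewrite addrAC lerDr addr_ge0// sumr_ge0// => j _.
  by rewrite addr_ge0.
(* Inner ball: the Taylor remainder is quadratic, and [|y| ^+ 2] equals [rho ^+ 2 * t ^+ 2] for the
   rescaled maximal coordinate [t]. *)
have [yr|yr] := leP `|y| rho.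
  have X_le : X <= d%:R * (2 * B + D) * `|y| ^+ 2.
    pose S' := \sum_i y ord0 i * f' i 0.
    have S'_le : `|S' - S| <= d%:R * (D * `|y| ^+ 2).
      rewrite /S' /S -sumrB; apply: le_trans (ler_norm_sum _ _ _) _.
      rewrite -[d in d%:R]card_ord -sum1_card natr_sum mulr_suml.
      apply: ler_sum => i _; rewrite mul1r [y ord0 i * _]mulrC -mulrBr normrM.
      apply: ler_pM => //; apply: le_trans (pbump_close _) _.
      rewrite -real_normK ?num_real// lerXn2r ?nnegrE//.
      exact: norm_coord.
    have H : `|f (0 + y) - f 0 - S'| <= d%:R * (2 * B * `|y| ^+ 2).
      apply: coord_telescope => i z t zy ty.
      set w := 0 + z.
      have t1 : `|t| <= 1 by rewrite (le_trans ty)// (le_trans yr).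
      have h1 := fd i w t t1; have h2 := f'L i w 0.
      rewrite subr0 {2}/w add0r in h2.
      have -> : f (w + t *: delta_mx ord0 i) - f w - t * f' i 0 =
        (f (w + t *: delta_mx ord0 i) - f w - t * f' i w)
        + t * (f' i w - f' i 0) by ring.
      apply: le_trans (ler_normD _ _) _.
      have tt : t ^+ 2 <= `|y| ^+ 2.
        by rewrite -real_normK ?num_real// lerXn2r ?nnegrE.
      have h3 : `|t * (f' i w - f' i 0)| <= B * `|y| ^+ 2.
        rewrite normrM expr2 mulrCA; apply: ler_pM => //.
        by rewrite (le_trans h2)// ler_wpM2l.
      have h4 : B * t ^+ 2 <= B * `|y| ^+ 2 by exact: ler_wpM2l.
      by have := lerD h1 h3; lra.
    rewrite add0r in H.
    have := lerD (le_trans (ler_norm _) H) (le_trans (ler_norm _) S'_le).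
    rewrite (_ : f y - f 0 - S' + (S' - S) = X); last by rewrite /X; ring.
    by move/le_trans; apply; lra.
  have [y0|y0] := eqVneq `|y| 0.
    rewrite y0 expr0n/= mulr0 in X_le; apply: le_trans X_le _.
    by apply: sumr_ge0 => i _; rewrite addr_ge0.
  have {}y0 : 0 < `|y| by rewrite lt_neqAle eq_sym y0/=.
  have [i yi] := norm_coord_attained y0.
  apply: (pick1 i _ X_le); rewrite yi real_normK ?num_real// mxE.
  set t := rho^-1 * y ord0 i.
  have -> : y ord0 i = rho * t by rewrite /t mulrA mulfV ?mul1r// gt_eqF.
  have t1 : `|t| <= 1.
    by rewrite normrM normfV (gtr0_norm rho0) ler_pdivrMl// mulr1 -yi.
  rewrite exprMn; have h := ler_wpM2l rr0 (chi_ge_sqr t1).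
  apply: (@le_trans _ _ (d%:R * (2 * B + D) * (rho ^+ 2 * (2 * chi t)))).
    by apply: ler_wpM2l => //; apply: mulr_ge0 => //; lra.
  rewrite [leLHS](_ : _ = 2 * (d%:R * (2 * B + D)) * (rho ^+ 2 * chi t)); last by ring.
  rewrite -[c * _ * _]mulrA; apply: ler_wpM2r; first exact: mulr_ge0 (chi_ge0 _).
  by rewrite /c; lra.
have [i yi] := norm_coord_attained (lt_trans rho0 yr).
(* Up to [rho^-1] both [f] and its slopes at 0 are of size [rho ^+ 2]; beyond it only the global
   bounds remain, paid by the second family of [chi] terms. *)
have [yR|yR] := leP `|y| rho^-1.
  have X_le : X <= (2 + d%:R * D) * rho ^+ 2.
    have h1 := frho y yR; have h2 : `|f 0| <= rho ^+ 2.
      by apply: frho; rewrite normr0 invr_ge0 ltW.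
    have h3 := S_le _ f'D.
    have := ler_norm (f y); have := ler_norm (- f 0); have := ler_norm (- S).
    by rewrite !normrN /X; lra.
  apply: (pick1 i _ X_le); rewrite mxE; set t := rho^-1 * y ord0 i.
  have t1 : 1 <= `|t|.
    by rewrite normrM normfV (gtr0_norm rho0) ler_pdivlMl// mulr1 -yi ltW.
  have h := ler_wpM2l rr0 (chi_ge_half t1); rewrite mulr1 in h.
  apply: (@le_trans _ _ ((2 + d%:R * D) * (rho ^+ 2 * (2 * chi t)))).
    by apply: ler_wpM2l => //; lra.
  rewrite [leLHS](_ : _ = 2 * (2 + d%:R * D) * (rho ^+ 2 * chi t)); last by ring.
  rewrite -[c * _ * _]mulrA; apply: ler_wpM2r; first exact: mulr_ge0 (chi_ge0 _).
  by rewrite /c; lra.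
have X_le : X <= 2 * K + d%:R * D.
  have h3 := S_le _ f'D1; have h1 := fK y; have h2 := fK 0.
  have := ler_norm (f y); have := ler_norm (- f 0); have := ler_norm (- S).
  by rewrite !normrN /X; lra.
apply: (pick2 i _ X_le); rewrite mxE; set t := rho * y ord0 i.
have t1 : 1 <= `|t|.
  by rewrite normrM (gtr0_norm rho0) -ler_pdivrMl// mulr1 -yi ltW.
have h := chi_ge_half t1.
apply: (@le_trans _ _ ((2 * K + d%:R * D) * (2 * chi t))).
  by rewrite ler_peMr//; lra.
rewrite mulrA; apply: ler_wpM2r; first exact: chi_ge0.
by rewrite /c; lra.
Qed.

End majorant.

(** Total boundedness of an interval, phrased as rounding down to a grid of mesh [tau] that starts
    at [- K]. *)
Lemma quantizer (R : realType) (K tau : R) : 0 < tau ->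
  exists N (c : R -> 'I_N.+1) (pt : 'I_N.+1 -> R),
    forall t, `|t| <= K -> `|t - pt (c t)| <= tau.
Proof.
move=> tau0; pose N := Num.truncn (2 * K / tau).
exists N, (fun t => inord (Num.truncn ((t + K) / tau))), (fun k => k%:R * tau - K).
move=> t; rewrite ler_norml => /andP[tK Kt].
have q0 : 0 <= (t + K) / tau by apply: divr_ge0; [lra|exact: ltW].
have /andP[q1 q2] := truncn_itv q0.
have qN : (Num.truncn ((t + K) / tau) <= N)%N.
  by apply: le_truncn; rewrite ler_pM2r ?invr_gt0//; lra.
rewrite inordK//; move: q1 q2; rewrite -natr1 ler_pdivlMr// ltr_pdivrMr//.
move: (Num.truncn _) => k; rewrite mulrDl mul1r ler_norml => q1 q2.
by apply/andP; split; lra.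
Qed.

(** * Consistency, uniformly over mollified functions *)

Section consistency.
Context {R : realType} {d : nat}.
Local Notation V := 'rV[R]_d.

Definition tstep (e : (V -> R) -> R) (alpha h : R) := step e (h `^ alpha^-1).

Definition consistent (e : (V -> R) -> R) (alpha : R) :=
  forall phi : V -> R, Cb3 phi ->
  exists G : V -> R, forall eta, 0 < eta -> exists2 h0, 0 < h0 &
    forall h, 0 < h < h0 -> forall x,
      `|tstep e alpha h phi x - phi x - h * G x| <= eta * h.

Variables (e : (V -> R) -> R) (alpha : R).
Hypotheses (e_sub : sublinear_law e) (alpha01 : 0 < alpha <= 1).
Hypothesis e_cons : consistent e alpha.
Local Notation T := (tstep e alpha).

Let alpha_gt0 : 0 < alpha. Proof. by case/andP: alpha01. Qed.

Lemma tstep0 v : T 0 v = v.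
Proof.
apply/funext => x; rewrite /tstep powR0 ?invr_eq0 ?gt_eqF// /step.
under [X in e X]eq_fun do rewrite scale0r addr0.
by case: e_sub.
Qed.

(** Small steps are governed by consistency; for [h >= h0] the trivial bound [2 * K] is at most
    [2 * K / h0 * h]. Large steps matter because dilating a test function dilates the step. *)
Lemma tstep_rate phi : Cb3 phi ->
  exists2 C, 0 <= C & forall h x, 0 <= h -> `|T h phi x - phi x| <= C * h.
Proof.
move=> phiC; have [K [L [K0 L0 phiKL]]] := bLip_blip (Cb3_bLip phiC).
have [G /(_ 1 ltr01)[h0 h0_gt0 GP]] := e_cons phiC.
have phiK h x : `|T h phi x - phi x| <= 2 * K.
  apply: le_trans (ler_normB _ _) _; rewrite mulr_natl mulr2n.
  by apply: lerD; [exact: (blip_step (h `^ alpha^-1) e_sub phiKL).1|exact: phiKL.1].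
pose h1 := h0 / 2; have h1_gt0 : 0 < h1 by rewrite divr_gt0.
have h1_lt : 0 < h1 < h0 by rewrite h1_gt0/= /h1; lra.
(* [G] is uniformly close to the difference quotient at the single step [h1], which is bounded
   because [phi] is. *)
have GB x : `|G x| <= 1 + 2 * K / h1.
  have := GP _ h1_lt x; rewrite mul1r; set D := T h1 phi x - phi x => H.
  rewrite -(ler_pM2l h1_gt0) -{1}(gtr0_norm h1_gt0) -normrM.
  rewrite (_ : h1 * G x = D - (D - h1 * G x)); last by ring.
  apply: le_trans (ler_normB _ _) _.
  have -> : h1 * (1 + 2 * K / h1) = h1 + 2 * K by field; rewrite gt_eqF.
  by have := phiK h1 x; rewrite -/D; lra.
have q1 : 0 <= 2 * K / h1 by rewrite divr_ge0 ?ltW// mulr_gt0.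
have q0 : 0 <= 2 * K / h0 by rewrite divr_ge0 ?ltW// mulr_gt0.
exists (2 + 2 * K / h1 + 2 * K / h0); first by lra.
move=> h x; rewrite le_eqVlt => /predU1P[<-|h_gt0].
  by rewrite tstep0 subrr normr0 mulr0.
have [hh|hh] := ltP h h0.
  have hh0 : 0 < h < h0 by rewrite h_gt0.
  have := GP _ hh0 x; rewrite mul1r; set D := T h phi x - phi x => H.
  rewrite -[D](subrK (h * G x)); apply: le_trans (ler_normD _ _) _.
  have : `|h * G x| <= h * (1 + 2 * K / h1).
    by rewrite normrM (gtr0_norm h_gt0) ler_pM2l.
  move: (2 * K / h1) (2 * K / h0) q1 q0 => a b a0 b0; nra.
apply: le_trans (phiK h x) _.
have : 2 * K <= 2 * K / h0 * h by rewrite mulrAC ler_pdivlMr// ler_pM2l// mulr_gt0.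
move: (2 * K / h1) (2 * K / h0) q1 q0 => a b a0 b0; nra.
Qed.

Lemma step_scale0 a r v : step e a (fun y => v (r *: y)) 0 = step e (a * r) v 0.
Proof.
rewrite /step; congr e; apply/funext => y.
by rewrite !add0r scalerA mulrC.
Qed.

(** Self-similarity: the product of [h^(1/alpha)] and [r] is [(h * r^alpha)^(1/alpha)], so dilating
    space by [r] at the origin amounts to multiplying the step by [r^alpha]. *)
Lemma tstep_scale0 h r v : 0 <= h -> 0 < r ->
  T h (fun y => v (r *: y)) 0 = T (h * r `^ alpha) v 0.
Proof.
move=> h0 r0; rewrite /tstep step_scale0 powRM ?powR_ge0//.
by rewrite -powRrM mulfV ?gt_eqF// powRr1// ltW.
Qed.

(** The negative of [pbump] is a test of its own: [T] is homogeneous only for nonnegative factors,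
    and the slopes in the majorant have either sign. *)
Lemma Cb3_coord_tests (i : 'I_d) :
  [/\ Cb3 (fun y : V => pbump (y ord0 i)), Cb3 (fun y : V => -1 * pbump (y ord0 i))
    & Cb3 (fun y : V => chi (y ord0 i))].
Proof.
have [ps qs] := @smoothb_pqbump R 3; split.
- exact: (smoothb_Cb3 i ps).
- exact: (smoothb_Cb3 i (smoothbZ (-1) ps)).
- apply: (smoothb_Cb3 i (g := chi)).
  rewrite (_ : chi = fun t => 1 + -1 * qbump t).
    by apply: smoothbD; [exact: smoothb_cst|exact: smoothbZ].
  by apply/funext => t; rewrite mulN1r.
Qed.

Lemma coord_tests_bound : exists2 C, 0 <= C & forall (i : 'I_d) h, 0 <= h ->
  [/\ T h (fun y : V => pbump (y ord0 i)) 0 <= C * h,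
      T h (fun y : V => -1 * pbump (y ord0 i)) 0 <= C * h
    & T h (fun y : V => chi (y ord0 i)) 0 <= C * h].
Proof.
have p0 : pbump 0 = 0 :> R by rewrite /pbump mul0r.
have c0 : chi 0 = 0 :> R by rewrite chiE expr0n/= mul0r.
have /choice[C CP] : forall i : 'I_d, exists C, 0 <= C /\ forall h, 0 <= h ->
  [/\ T h (fun y : V => pbump (y ord0 i)) 0 <= C * h,
      T h (fun y : V => -1 * pbump (y ord0 i)) 0 <= C * h
    & T h (fun y : V => chi (y ord0 i)) 0 <= C * h].
  move=> i; have [t1 t2 t3] := Cb3_coord_tests i.
  have [C1 C10 H1] := tstep_rate t1; have [C2 C20 H2] := tstep_rate t2.
  have [C3 C30 H3] := tstep_rate t3.
  exists (C1 + C2 + C3); split=> [|h h0]; first by lra.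
  have m1 := mulr_ge0 C10 h0; have m2 := mulr_ge0 C20 h0.
  have m3 := mulr_ge0 C30 h0.
  have := H1 h 0 h0; have := H2 h 0 h0; have := H3 h 0 h0.
  rewrite !mxE p0 c0 mulr0 !subr0.
  by move=> /(le_trans (ler_norm _)) ? /(le_trans (ler_norm _)) ?
    /(le_trans (ler_norm _)) ?; split; lra.
exists (\sum_i C i); first by apply: sumr_ge0 => i _; exact: (CP i).1.
move=> i h h0; have [_ /(_ h h0)[a1 a2 a3]] := CP i.
have Ch : C i * h <= (\sum_i C i) * h.
  apply: ler_wpM2r => //; rewrite (bigD1 i)//= lerDl.
  by apply: sumr_ge0 => j _; exact: (CP j).1.
by split; exact: le_trans Ch.
Qed.

Variable eps : R.
Hypotheses (eps_gt0 : 0 < eps) (eps_le1 : eps <= 1).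
Local Notation mollify := (avgs eps (@word3 d)).

(* Subtracting [\sum_i f' i 0 * pbump y_i] from the increment of a mollified
   function leaves an error which is quadratic near 0, small on a large ball and
   bounded outside; (A2) for the finitely many coordinate tests bounds each part,
   the truncation radii entering through the self-similarity [tstep_scale0]. *)
Lemma mollify_equicontinuous K L eta : 0 <= K -> 0 <= L -> 0 < eta ->
  exists delta r : R, [/\ 0 < delta, 0 < r & forall g, blip K L g ->
    (forall y, `|y| <= r -> `|g y| <= delta) ->
    forall h, 0 <= h -> T h (mollify g) 0 - mollify g 0 <= eta * h].
Proof.
move=> K0 L0 eta0; have [C C0 CP] := coord_tests_bound.
pose B := 2 * L / eps; pose D := 2 / eps.
have B0 : 0 <= B by apply: divr_ge0; [exact: mulr_ge0|exact: ltW].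
have D0 : 0 <= D by apply: divr_ge0; [|exact: ltW].
pose c := 2 * (2 * K + 2 + d%:R * (2 * B + 2 * D)).
have c0 : 0 <= c.
  by rewrite /c mulr_ge0// addr_ge0// ?mulr_ge0//; lra.
pose A := d%:R * (C * (D + 2 * c)).
have A0 : 0 <= A by rewrite /A !mulr_ge0//; lra.
pose b := Num.min 1 (eta / (A + 1)).
have b0 : 0 < b by rewrite lt_min ltr01/= divr_gt0//; lra.
have b1 : b <= 1 by rewrite ge_min lexx.
have Ab : A * b <= eta.
  have : b <= eta / (A + 1) by rewrite ge_min lexx orbT.
  rewrite ler_pdivlMr; last by lra.
  by move: b0; nra.
(* This choice makes every contribution of order [b * h]: outer tests carry [rho^alpha = b], and
   slopes carry [rho ^+ 2 <= b]. Inner tests carry [rho ^+ 2 * rho^-alpha], which is at most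
   [rho <= b] because [alpha <= 1]. *)
pose rho := b `^ alpha^-1.
have rho0 : 0 < rho by exact: powR_gt0.
have rhoa : rho `^ alpha = b.
  by rewrite /rho -powRrM mulVf ?gt_eqF// powRr1// ltW.
have rho_le : rho <= b.
  apply: ge1r_powR; first by rewrite b0.
  by rewrite invf_ge1//; case/andP: alpha01.
have rho1 : rho <= 1 by exact: le_trans b1.
have rhoV : rho ^+ 2 * rho^-1 `^ alpha <= rho.
  have -> : rho ^+ 2 = rho * (rho `^ alpha * rho `^ (1 - alpha)).
    rewrite -powRD; last by rewrite (gt_eqF rho0) implybT.
    by rewrite [alpha + _]addrC subrK powRr1// ltW.
  rewrite -mulrA; apply: ler_piMr; first exact: ltW.
  have -> : rho^-1 `^ alpha = (rho `^ alpha)^-1.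
    by rewrite -[rho^-1]powR_inv1 ?ltW// -powRrM mulN1r powRN.
  have ra_neq0 : rho `^ alpha != 0 by rewrite gt_eqF// powR_gt0.
  rewrite mulrAC mulfV// mul1r.
  by rewrite -[leRHS](powRr0 rho); apply: ger_powR; [rewrite rho0|
    case/andP: alpha01; rewrite subr_ge0].
(* The summand [size word3] accounts for the reach of the averages; the remaining margin covers the
   shift by [eps <= 1] in the difference quotients. *)
exists (rho ^+ 2), (rho^-1 + (size (@word3 d))%:R + 2).
have rV0 : 0 < rho^-1 by rewrite invr_gt0.
have m0 : 0 <= (size (@word3 d))%:R :> R by [].
split; [exact: exprn_gt0|lra|move=> g gKL gsmall h h0].
have gb := blip_bLip gKL.
set f := mollify g.
pose f' i := avgs eps (rem i (@word3 d)) (diffq eps i g).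
have fb : bLip f by exact: bLip_avgs.
have i_in i : i \in @word3 d by rewrite -has_pred1 has_count count_word3.
have f'0 i : `|f' i 0| <= D * rho ^+ 2.
  apply: avgs_local => //; first exact: bLip_diffq.
  move=> y; rewrite subr0 => ym.
  have {}ym : `|y| <= (size (@word3 d))%:R.
    apply: le_trans ym _; apply: (@le_trans _ _ (size (rem i (@word3 d)))%:R).
      by rewrite ler_piMl.
    by rewrite ler_nat size_rem// leq_pred.
  have g1 : `|g y| <= rho ^+ 2 by apply: gsmall; lra.
  have g2 : `|g (eps *: delta_mx ord0 i + y)| <= rho ^+ 2.
    apply: gsmall; apply: le_trans (ler_normD _ _) _.
    have := norm_scale_delta_le i eps; rewrite (gtr0_norm eps_gt0).
    by have := eps_le1; lra.
  rewrite /diffq normrM normfV (gtr0_norm eps_gt0) /D mulrAC [leRHS]mulrC.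
  apply: ler_wpM2l; first by rewrite invr_ge0 ltW.
  by apply: le_trans (ler_normB _ _) _; lra.
have maj : forall y, f y - f 0 <= \sum_i (f' i 0 * pbump (y ord0 i)
    + (c * rho ^+ 2 * chi ((rho^-1 *: y) ord0 i) + c * chi ((rho *: y) ord0 i))).
  apply: (@taylor_majorant _ _ f f' K B D rho) => //.
  - by rewrite rho0.
  - move=> i x t t1; apply: le_trans (avgs_partial eps_gt0 gKL (i_in i) x t1) _.
    by rewrite (ger0_norm L0).
  - move=> i x y.
    exact: ((blip_avgs eps_gt0 _ (blip_diffq eps_gt0 i gKL)).2 x y).
  - by move=> y; exact: (blip_avgs eps_gt0 _ gKL).1.
  - move=> y yr; apply: avgs_local => // z zy; apply: gsmall.
    rewrite -[z](subrK y); apply: le_trans (ler_normD _ _) _.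
    have : eps * (size (@word3 d))%:R <= (size (@word3 d))%:R by rewrite ler_piMl.
    by lra.
have p_b i : bLip (fun y : V => pbump (y ord0 i)).
  by have [/Cb3_bLip] := Cb3_coord_tests i.
have chi_b i : bLip (fun y : V => chi (y ord0 i)).
  by have [_ _ /Cb3_bLip] := Cb3_coord_tests i.
have chi_rb i r : bLip (fun y : V => chi ((r *: y) ord0 i)).
  have := bLip_affine 0 r (chi_b i).
  by under eq_fun do rewrite add0r.
have t1b i : bLip (fun y : V => f' i 0 * pbump (y ord0 i)) by exact: bLipZ.
have t2b i : bLip (fun y : V => c * rho ^+ 2 * chi ((rho^-1 *: y) ord0 i)
    + c * chi ((rho *: y) ord0 i)).
  by apply: bLipD; apply: bLipZ.
have tb i : bLip (fun y : V => f' i 0 * pbump (y ord0 i)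
    + (c * rho ^+ 2 * chi ((rho^-1 *: y) ord0 i) + c * chi ((rho *: y) ord0 i))).
  exact: bLipD.
have sumb := bLip_sum (index_enum 'I_d) tb.
rewrite lerBlDr; apply: (@le_trans _ _ (T h (fun y : V =>
   \sum_i (f' i 0 * pbump (y ord0 i) + (c * rho ^+ 2 * chi ((rho^-1 *: y) ord0 i)
     + c * chi ((rho *: y) ord0 i)))) 0 + f 0)).
  by apply: step_leD => // y; rewrite -lerBlDr; exact: maj.
rewrite lerD2r; apply: le_trans (step_sum _ _ _ _ tb) _ => //.
have term i : T h (fun y : V => f' i 0 * pbump (y ord0 i)
    + (c * rho ^+ 2 * chi ((rho^-1 *: y) ord0 i) + c * chi ((rho *: y) ord0 i))) 0
    <= C * (D + 2 * c) * b * h.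
  have [p1 p2 _] := CP i h h0.
  have h1 : T h (fun y : V => f' i 0 * pbump (y ord0 i)) 0 <= D * b * (C * h).
    have Ch : 0 <= C * h by exact: mulr_ge0.
    have f'b : `|f' i 0| <= D * b.
      apply: le_trans (f'0 i) _; apply: ler_wpM2l => //.
      by rewrite expr2 (le_trans _ rho_le)// ler_piMr// ltW.
    apply: (@le_trans _ _ (`|f' i 0| * (C * h))); last exact: ler_wpM2r.
    have [q0|q0] := leP 0 (f' i 0).
      rewrite (ger0_norm q0) /tstep stepZ//.
      exact: (ler_wpM2l q0 p1).
    rewrite (ltr0_norm q0).
    rewrite (_ : (fun y : V => _) = (fun y => - f' i 0 * (-1 * pbump (y ord0 i)))).
      have nq0 : 0 <= - f' i 0 by rewrite oppr_ge0 ltW.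
      rewrite /tstep stepZ//; [exact: (ler_wpM2l nq0 p2)|exact: bLipZ].
    by apply/funext => y; rewrite mulrA mulrN1 opprK.
  have chi_s r : 0 < r ->
      T h (fun y : V => chi ((r *: y) ord0 i)) 0 <= C * (h * r `^ alpha).
    move=> r0; rewrite (tstep_scale0 (fun y : V => chi (y ord0 i)) h0 r0).
    by have [_ _] := CP i (h * r `^ alpha) (mulr_ge0 h0 (powR_ge0 _ _)).
  have h2 : T h (fun y : V => c * rho ^+ 2 * chi ((rho^-1 *: y) ord0 i)) 0
      <= c * b * (C * h).
    rewrite /tstep stepZ//; last by rewrite mulr_ge0// sqr_ge0.
    apply: (@le_trans _ _ (c * rho ^+ 2 * (C * (h * rho^-1 `^ alpha)))).
      by apply: ler_wpM2l; [rewrite mulr_ge0// sqr_ge0|exact: chi_s].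
    rewrite [leLHS](_ : _ = c * (rho ^+ 2 * rho^-1 `^ alpha) * (C * h)); last by ring.
    apply: ler_wpM2r; first exact: mulr_ge0.
    by apply: ler_wpM2l => //; exact: le_trans rho_le.
  have h3 : T h (fun y : V => c * chi ((rho *: y) ord0 i)) 0 <= c * b * (C * h).
    rewrite /tstep stepZ//; apply: (@le_trans _ _ (c * (C * (h * rho `^ alpha)))).
      by apply: ler_wpM2l => //; exact: chi_s.
    by rewrite rhoa [leRHS](_ : _ = c * (C * (h * b)))//; ring.
  apply: le_trans (stepD _ e_sub _ (t1b i) (t2b i)) _.
  apply: le_trans (lerD h1 (stepD _ e_sub _ _ _)) _; [exact: bLipZ|exact: bLipZ|].
  apply: le_trans (lerD (lexx _) (lerD h2 h3)) _.
  by rewrite [leRHS](_ : _ = D * b * (C * h) + (c * b * (C * h) + c * b * (C * h)))//; ring.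
apply: le_trans (ler_sum _ (fun i _ => term i)) _.
rewrite sumr_const card_ord -[leLHS]mulr_natl mulrA.
by apply: ler_wpM2r => //; apply: le_trans Ab; rewrite /A !mulrA.
Qed.

(* (A2) is only pointwise in the test function. Quantizing the values of [w] on
   a finite grid sorts the mollified functions into finitely many classes, on
   each of which one representative controls all members by equicontinuity. *)
Lemma mollify_consistent K L eta : 0 <= K -> 0 <= L -> 0 < eta ->
  exists2 h0, 0 < h0 & forall w, blip K L w -> forall x, exists G,
    forall h, 0 < h < h0 ->
      `|T h (mollify w) x - mollify w x - h * G| <= eta * h.
Proof.
move=> K0 L0 eta0; have eta2 : 0 < eta / 2 by rewrite divr_gt0.
have [delta [r [delta0 r0 equi]]] :=
  mollify_equicontinuous (addr_ge0 K0 K0) (addr_ge0 L0 L0) eta2.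
(* Two functions of one class are compared through a node and a grid value: each contributes
   [L * tau] for moving to the node and [tau] for rounding its value. *)
pose tau := delta / (2 * L + 2).
have L2 : 0 < 2 * L + 2 by lra.
have tau0 : 0 < tau by exact: divr_gt0.
have tauE : (2 * L + 2) * tau = delta by rewrite /tau mulrC divfK// gt_eqF.
have [N1 [c1 [pt1 q1]]] := quantizer r tau0.
have [N2 [c2 [pt2 q2]]] := quantizer K tau0.
(* The nodes form a product grid for the ball of radius [r]; the color of [w] is the finite table of
   its rounded values at the nodes. *)
pose node (k : {ffun 'I_d -> 'I_N1.+1}) : V := \row_j pt1 (k j).
pose color (w : V -> R) := [ffun k => c2 (w (node k))].
have close w w' : blip K L w -> blip K L w' -> color w = color w' ->
    forall y, `|y| <= r -> `|w y - w' y| <= delta.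
  move=> wb wb' cE y yr; pose k := [ffun j => c1 (y ord0 j)].
  have yk : `|y - node k| <= tau.
    apply: norm_le_coord; first exact: ltW.
    by move=> j; rewrite !mxE ffunE; apply: q1; exact: le_trans (norm_coord _ _) yr.
  have ck : c2 (w (node k)) = c2 (w' (node k)).
    by have := congr1 (fun f : {ffun _ -> _} => f k) cE; rewrite !ffunE.
  have a1 := q2 _ (wb.1 (node k)); have a2 := q2 _ (wb'.1 (node k)).
  rewrite -ck in a2; set p := pt2 _ in a1 a2.
  have b1 := le_trans (wb.2 y (node k)) (ler_wpM2l L0 yk).
  have b2 := le_trans (wb'.2 y (node k)) (ler_wpM2l L0 yk).
  have -> : w y - w' y = (w y - w (node k)) + (w (node k) - p)
    - (w' (node k) - p) - (w' y - w' (node k)) by ring.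
  rewrite -tauE; apply: le_trans (ler_normB _ _) _.
  apply: le_trans (lerD (ler_normB _ _) (lexx _)) _.
  apply: le_trans (lerD (lerD (ler_normD _ _) (lexx _)) (lexx _)) _.
  apply: le_trans (lerD (lerD (lerD b1 a1) a2) b2) _; lra.
have incr w w' h : blip K L w -> blip K L w' -> color w = color w' -> 0 <= h ->
    (T h (mollify w) 0 - mollify w 0) - (T h (mollify w') 0 - mollify w' 0)
      <= eta / 2 * h.
  move=> wb wb' cE h0; have wL := blip_bLip wb; have wL' := blip_bLip wb'.
  have := equi _ (blipD wb (blipN wb')) (close _ _ wb wb' cE) h h0.
  rewrite avgsB//; apply: le_trans.
  have := step_subadd (h `^ alpha^-1) e_sub 0 (bLip_avgs eps_gt0 word3 wL)
    (bLip_avgs eps_gt0 word3 wL').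
  by rewrite /tstep; lra.
have /choice[p pP] : forall t, exists p : R * R, 0 < p.1 /\
    forall w, blip K L w -> color w = t -> forall h, 0 < h < p.1 ->
      `|T h (mollify w) 0 - mollify w 0 - h * p.2| <= eta * h.
  move=> t; have [[w0 [w0b w0t]]|nw] :=
    pselect (exists w0, blip K L w0 /\ color w0 = t); last first.
    by exists (1, 0); split=> // w wb wt; case: nw; exists w.
  have [G /(_ _ eta2)[h0 h0_gt0 GP]] :=
    e_cons (Cb3_avgs eps_gt0 (blip_bLip w0b)).
  exists (h0, G 0); split=> //= w wb wt h hh0.
  have /andP[h_gt0 _] := hh0; have := GP _ hh0 0; rewrite !ler_norml.
  have cE : color w = color w0 by rewrite wt.
  have := incr w w0 h wb w0b cE (ltW h_gt0).
  have := incr w0 w h w0b wb (esym cE) (ltW h_gt0).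
  by move=> i1 i2 /andP[g1 g2]; apply/andP; split; lra.
exists (\big[Num.min/1]_t (p t).1).
  by apply: lt_bigmin => // t _; exact: (pP t).1.
(* Translation brings [x] to the origin and preserves the class [blip K L], so the threshold does
   not depend on [x]; only the value [G] does. *)
move=> w wb x; pose wx y := w (x + y).
have wxb : blip K L wx by exact: blip_shift.
exists (p (color wx)).2 => h /andP[h_gt0 hm].
have [_ /(_ wx wxb erefl h)] := pP (color wx).
rewrite /wx avgs_shift /tstep step_shift !addr0.
apply; rewrite h_gt0/=; apply: lt_le_trans hm _.
exact: bigmin_le.
Qed.

End consistency.

(** * Linear interpolation in time *)

Section interpolation.
Context {R : realType} {d : nat}.
Local Notation V := 'rV[R]_d.
Variables (v : nat -> V -> R) (n : nat).
Hypothesis n_gt0 : (0 < n)%N.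

(** Index [l] stands for time [l / n] in units of the step of [v]: each step is divided into [n]
    equal ticks. *)
Definition interp (l : nat) (x : V) : R :=
  v (l %/ n) x + n%:R^-1 * (l %% n)%:R * (v (l %/ n).+1 x - v (l %/ n) x).

Lemma interpS l x : interp l.+1 x =
  interp l x + n%:R^-1 * (v (l %/ n).+1 x - v (l %/ n) x).
Proof.
have n0 : n%:R != 0 :> R by rewrite pnatr_eq0 -lt0n.
rewrite /interp modnS divnS//; case: ifPn => [nl|_]; last first.
  by rewrite add0n -natr1; ring.
have -> : (l %% n)%:R = n%:R - 1 :> R.
  have ln : (l %% n).+1 = n.
    apply/eqP; rewrite eqn_leq ltn_mod n_gt0/= dvdn_leq//.
    by move: nl; rewrite {1}(divn_eq l n) -addnS dvdn_addr// dvdn_mull.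
  by rewrite -[in RHS]ln -natr1 addrK.
by rewrite add1n mulr0 mul0r; field.
Qed.

Lemma interp_mul l x : interp (l * n) x = v l x.
Proof. by rewrite /interp mulnK// modnMl mulr0 mul0r addr0. Qed.

Lemma interp_weight l : 0 <= (n%:R^-1 * (l %% n)%:R : R) <= 1.
Proof.
rewrite mulr_ge0 ?invr_ge0//= ler_pdivrMl ?ltr0n// mulr1 ler_nat.
by rewrite ltnW// ltn_mod.
Qed.

Lemma blip_interp K L l : (forall k, blip K L (v k)) -> blip K L (interp l).
Proof.
move=> vb; rewrite /interp.
move: (n%:R^-1 * _) (interp_weight l) => t /andP[t0 t1]; set j := (l %/ n)%N.
split=> [x|x y].
  have -> : v j x + t * (v j.+1 x - v j x) = (1 - t) * v j x + t * v j.+1 x.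
    by ring.
  apply: le_trans (ler_normD _ _) _; rewrite !normrM.
  rewrite (ger0_norm t0) [`|1 - t|]ger0_norm ?subr_ge0//.
  have h1 := (vb j).1 x; have h2 := (vb j.+1).1 x.
  have t1' : 0 <= 1 - t by rewrite subr_ge0.
  by have := lerD (ler_wpM2l t1' h1) (ler_wpM2l t0 h2); lra.
have -> : v j x + t * (v j.+1 x - v j x) - (v j y + t * (v j.+1 y - v j y))
    = (1 - t) * (v j x - v j y) + t * (v j.+1 x - v j.+1 y) by ring.
apply: le_trans (ler_normD _ _) _; rewrite !normrM.
rewrite (ger0_norm t0) [`|1 - t|]ger0_norm ?subr_ge0//.
have h1 := (vb j).2 x y; have h2 := (vb j.+1).2 x y.
have t1' : 0 <= 1 - t by rewrite subr_ge0.
by have := lerD (ler_wpM2l t1' h1) (ler_wpM2l t0 h2); lra.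
Qed.

Lemma interp_dist C : (forall k x, `|v k.+1 x - v k x| <= C) ->
  forall i q x, `|interp (i + q) x - interp i x| <= q%:R * (n%:R^-1 * C).
Proof.
move=> vC i; elim=> [|q ih] x; first by rewrite addn0 subrr normr0 mul0r.
rewrite addnS interpS addrAC -natr1 mulrDl mul1r.
apply: le_trans (ler_normD _ _) _; apply: lerD => //.
rewrite normrM ger0_norm ?invr_ge0//.
by apply: ler_wpM2l; rewrite ?invr_ge0.
Qed.

Lemma interp_node_dist C l x : (forall k x, `|v k.+1 x - v k x| <= C) ->
  `|v (l %/ n) x - interp l x| <= C.
Proof.
move=> vC; rewrite /interp opprD addrA subrr add0r normrN normrM.
have /andP[t0 t1] := interp_weight l; rewrite (ger0_norm t0).
by apply: le_trans (ler_wpM2l t0 (vC _ x)) _; rewrite ler_piMl// (le_trans _ (vC 0%N x)).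
Qed.

End interpolation.

(** * Convergence of the iterates and their expansion in time *)

Section convergence.
Context {R : realType} {d : nat}.
Local Notation V := 'rV[R]_d.
Variables (e : (V -> R) -> R) (alpha : R).
Hypotheses (e_sub : sublinear_law e) (alpha01 : 0 < alpha <= 1).
Hypothesis e_cons : consistent e alpha.
Local Notation T := (tstep e alpha).

Lemma iter_rate phi C : bLip phi ->
  (forall h x, 0 <= h -> `|T h phi x - phi x| <= C * h) ->
  forall k h x, 0 <= h -> `|iter k.+1 (T h) phi x - iter k (T h) phi x| <= C * h.
Proof.
move=> phib CP k h; elim: k => [|k ih] x h0; first exact: CP.
have [K [L [_ _ pKL]]] := bLip_blip phib.
have itb m : bLip (iter m (T h) phi).
  exact: blip_bLip (blip_iter_step _ e_sub m pKL).
by apply: (step_dist _ e_sub (itb k.+1) (itb k)) => y; exact: ih.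
Qed.

Lemma avgs_dist (eps : R) W (w w' : V -> R) B : 0 < eps -> bLip w -> bLip w' ->
  (forall x, `|w x - w' x| <= B) ->
  forall x, `|avgs eps W w x - avgs eps W w' x| <= B.
Proof.
move=> eps0 wb wb' ww' x.
have := congr1 (@^~ x) (avgsB eps0 W wb wb') => /= <-.
by apply: avgs_local => //; exact: bLipB.
Qed.

(** * Comparison of the schemes with steps [s / n] and [s / n'] *)

Section comparison.
Variables (eps K L C eta h0 hs s : R) (phi : V -> R) (n n' : nat).
Hypotheses (eps_gt0 : 0 < eps) (eps_le1 : eps <= 1) (L_ge0 : 0 <= L).
Hypotheses (hs_gt0 : 0 < hs) (hs_lt : hs < h0).
Hypotheses (phib : blip K L phi) (s_gt0 : 0 < s).
Hypotheses (n_gt0 : (0 < n)%N) (n'_gt0 : (0 < n')%N).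
Local Notation mollify := (avgs eps (@word3 d)).
Local Notation h := (s / n%:R).
Local Notation h' := (s / n'%:R).
Hypothesis mcons : forall w, blip K L w -> forall x, exists G, forall t, 0 < t < h0 ->
  `|T t (mollify w) x - mollify w x - t * G| <= eta * t.
Hypothesis phi_rate : forall t x, 0 <= t -> `|T t phi x - phi x| <= C * t.
Hypotheses (h_lt : h < h0) (h'_lt : h' < h0).
Hypothesis hh'_small : 2 * C * (h + h') <= eta * hs.

Let h_gt0 : 0 < h. Proof. by rewrite divr_gt0// ltr0n. Qed.
Let h'_gt0 : 0 < h'. Proof. by rewrite divr_gt0// ltr0n. Qed.

(** Stand-in for the generator at the mollified function. Its step [hs] stays fixed while [h] and
    [h'] shrink, so it depends continuously on [w] in the uniform norm. *)
Let D w x := (T hs (mollify w) x - mollify w x) / hs.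

(** The value [G] from consistency is eliminated by using it at both steps [t] and [hs]; each use
    costs one [eta]. *)
Lemma mollify_rate w x t : blip K L w -> 0 < t < h0 ->
  `|T t (mollify w) x - mollify w x - t * D w x| <= 2 * eta * t.
Proof.
move=> wb th0; have [G GP] := mcons wb x; have g1 := GP _ th0.
have hsP : 0 < hs < h0 by rewrite hs_gt0.
have := GP _ hsP; have /andP[t0 _] := th0.
have -> : T hs (mollify w) x - mollify w x = hs * D w x.
  by rewrite /D mulrC divfK// gt_eqF.
rewrite -mulrBr normrM (gtr0_norm hs_gt0) [eta * _]mulrC ler_pM2l// => g2.
have -> : T t (mollify w) x - mollify w x - t * D w x =
  (T t (mollify w) x - mollify w x - t * G) - t * (D w x - G) by ring.
apply: le_trans (ler_normB _ _) _; rewrite normrM (gtr0_norm t0).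
by have := ler_wpM2l (ltW t0) g2; move: g1; lra.
Qed.

Lemma mollify_rate_dist w w' x B : blip K L w -> blip K L w' ->
  (forall y, `|w y - w' y| <= B) -> `|D w x - D w' x| <= 2 * B / hs.
Proof.
move=> wb wb' ww'; have wL := blip_bLip wb; have wL' := blip_bLip wb'.
have mB := avgs_dist word3 eps_gt0 wL wL' ww'.
have TB := step_dist (hs `^ alpha^-1) e_sub (bLip_avgs eps_gt0 word3 wL)
  (bLip_avgs eps_gt0 word3 wL') mB.
rewrite /D -mulrBl normrM normfV (gtr0_norm hs_gt0) ler_pM2r ?invr_gt0//.
have := TB x; have := mB x; rewrite /tstep.
set a := step _ _ _ _; set b := step _ _ _ _; set p := avgs _ _ _ _.
set q := avgs _ _ _ _ => pq ab.
have -> : a - p - (b - q) = (a - b) - (p - q) by ring.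
by apply: le_trans (ler_normB _ _) _; lra.
Qed.

Local Notation v := (fun k => iter k (T h') phi).
Local Notation w := (interp v n).

Let vb k : blip K L (v k).
Proof. exact: blip_iter_step. Qed.

Let wb l : blip K L (w l).
Proof. exact: blip_interp. Qed.

Let v_rate k x : `|v k.+1 x - v k x| <= C * h'.
Proof. exact: iter_rate (blip_bLip phib) phi_rate _ _ _ (ltW h'_gt0). Qed.

(** Over at most [n'] ticks the interpolation moves by at most [C * h], and passing to the preceding
    node costs [C * h']. Dividing by [hs] is harmless thanks to [hh'_small]. *)
Lemma interp_rate_dist i q x : (q <= n')%N ->
  `|D (v ((i + q) %/ n)%N) x - D (w i) x| <= eta.
Proof.
move=> qn'; have C0 : 0 <= C.
  have := le_trans (normr_ge0 _) (phi_rate 0 ler01).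
  by rewrite mulr1.
apply: (@le_trans _ _ (2 * (C * h' + C * h) / hs)).
  apply: mollify_rate_dist; [exact: vb|exact: wb|move=> y].
  rewrite -(subrKA (w (i + q)%N y)); apply: le_trans (ler_normD _ _) _.
  apply: lerD; first exact: (@interp_node_dist _ _ v n n_gt0).
  apply: le_trans (@interp_dist _ _ v n n_gt0 _ v_rate i q y) _.
  have -> : C * h = n'%:R * (n%:R^-1 * (C * h')).
    by field; rewrite !pnatr_eq0 -!lt0n n_gt0 n'_gt0.
  apply: ler_wpM2r; last by rewrite ler_nat.
  by rewrite !mulr_ge0// ?invr_ge0// ltW.
by rewrite ler_pdivrMr//; move: hh'_small; lra.
Qed.

(* The scheme with step [h'], mollified in space and interpolated in time, is a
   smooth supersolution: mollification preserves supersolutions because [T h']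
   is sublinear ([step_avgs]). *)
Lemma mollify_interp_super i q x : (q <= n')%N ->
  mollify (w i) x + q%:R * (n%:R^-1 * h') * (D (w i) x - 3 * eta)
    <= mollify (w (i + q)%N) x.
Proof.
elim: q => [|q ih] qn'; first by rewrite mul0r mul0r addr0 addn0.
have {}ih := ih (ltnW qn').
set j := ((i + q) %/ n)%N.
have vbL k := blip_bLip (vb k).
have tau0 : 0 <= n%:R^-1 * h' by rewrite mulr_ge0 ?invr_ge0// ltW.
have mS : mollify (w (i + q).+1) x =
    mollify (w (i + q)%N) x + n%:R^-1 * (mollify (v j.+1) x - mollify (v j) x).
  have -> : w (i + q).+1 = fun y => w (i + q)%N y + n%:R^-1 * (v j.+1 y - v j y).
    by apply/funext => y; exact: interpS.
  have wL := blip_bLip (wb (i + q)%N).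
  have dL := bLipB (vbL j.+1) (vbL j).
  by rewrite avgsD ?avgsZ ?avgsB//; exact: bLipZ.
have h'P : 0 < h' < h0 by rewrite h'_gt0.
have jensen : T h' (mollify (v j)) x <= mollify (v j.+1) x.
  exact: step_avgs.
have /andP[rate _] : - (2 * eta * h') <= T h' (mollify (v j)) x - mollify (v j) x
    - h' * D (v j) x <= 2 * eta * h'.
  by rewrite -ler_norml; exact: mollify_rate.
have /andP[dd _] : - eta <= D (v j) x - D (w i) x <= eta.
  by rewrite -ler_norml; exact: interp_rate_dist (ltnW qn').
rewrite addnS mS -[q.+1%:R]natr1.
(* The loss [3 * eta] is [2 * eta] from consistency at step [h'] plus [eta] for freezing [D] at the
   initial index. *)
have m1 : h' * (D (w i) x - 3 * eta) <= mollify (v j.+1) x - mollify (v j) x.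
  have := ler_wpM2l (ltW h'_gt0) dd; lra.
rewrite [leLHS](_ : _ = mollify (w i) x
    + q%:R * (n%:R^-1 * h') * (D (w i) x - 3 * eta)
    + n%:R^-1 * (h' * (D (w i) x - 3 * eta))); last by ring.
by apply: lerD => //; apply: ler_wpM2l => //; rewrite invr_ge0.
Qed.

(** Discrete comparison principle: one step [h] equals [n'] ticks of length [h' / n]. The rate
    [5 * eta] adds the consistency error [2 * eta] at step [h] to the loss [3 * eta] of the
    supersolution. *)
Lemma iter_le_mollify k x :
  iter k (T h) phi x <= mollify (w (k * n')%N) x
    + (L * eps * (size (@word3 d))%:R + k%:R * (5 * eta * h)).
Proof.
elim: k x => [|k ih] x /=.
  have -> : w (0 * n')%N = phi.
    by apply/funext => y; exact: (@interp_mul _ _ v n n_gt0 0 y).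
  have := avgs_close eps_gt0 word3 x L_ge0 phib.
  by rewrite mul0r addr0 ler_norml => /andP[+ _]; lra.
have itb : bLip (iter k (T h) phi) := blip_bLip (blip_iter_step _ e_sub k phib).
have mb : bLip (mollify (w (k * n')%N)) := bLip_avgs eps_gt0 word3 (blip_bLip (wb _)).
apply: le_trans (step_leD _ e_sub itb mb ih x) _.
have hP : 0 < h < h0 by rewrite h_gt0.
have := mollify_rate x (wb (k * n')%N) hP; rewrite ler_norml => /andP[_ rate].
have := mollify_interp_super (k * n')%N x (leqnn n').
have -> : n'%:R * (n%:R^-1 * h') = h.
  by field; rewrite !pnatr_eq0 -!lt0n n_gt0 n'_gt0.
rewrite [in w (_ + _)%N]addnC -mulSn -natr1 => super.
move: rate; rewrite /tstep; lra.
Qed.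

Lemma iter_le_iter x : iter n (T h) phi x <= iter n' (T h') phi x
    + (2 * (L * eps * (size (@word3 d))%:R) + 5 * eta * s).
Proof.
apply: le_trans (iter_le_mollify n x) _; rewrite mulnC.
(* At the final time both schemes sit at a node, so the interpolation disappears and only a second
   mollification error is added. *)
have -> : w (n' * n)%N = v n' by apply/funext => y; rewrite interp_mul.
have := avgs_close eps_gt0 word3 x L_ge0 (vb n').
have -> : n%:R * (5 * eta * h) = 5 * eta * s.
  by field; rewrite pnatr_eq0 -lt0n.
by rewrite ler_norml => /andP[_]; lra.
Qed.

End comparison.

Lemma eps_choice (c eta : R) : 0 <= c -> 0 < eta ->
  exists eps : R, [/\ 0 < eps, eps <= 1 & c * eps <= eta].
Proof.
move=> c0 eta0; exists (Num.min 1 (eta / (c + 1))).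
have c1 : 0 < c + 1 by lra.
set t := Num.min _ _; have t0 : 0 < t by rewrite lt_min ltr01/= divr_gt0.
split=> //; first by rewrite ge_min lexx.
have : t <= eta / (c + 1) by rewrite ge_min lexx orbT.
by rewrite ler_pdivlMr//; nra.
Qed.

(** A one-sided bound suffices, since [n] and [n'] may be exchanged. Half of [eta] pays for the two
    mollification errors, half for [5 * eta1 * s] with [s <= 1]. *)
Lemma iter_cauchy phi (s eta : R) : Cb3 phi -> 0 < s <= 1 -> 0 < eta ->
  exists N, forall n n' x, (N < n)%N -> (N < n')%N ->
    iter n (T (s / n%:R)) phi x <= iter n' (T (s / n'%:R)) phi x + eta.
Proof.
move=> phiC /andP[s0 s1] eta0.
have [K [L [K0 L0 phib]]] := bLip_blip (Cb3_bLip phiC).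
have [C C0 CP] := tstep_rate e_sub alpha01 e_cons phiC.
pose m : R := (size (@word3 d))%:R.
have m0 : 0 <= m by [].
have Lm0 : 0 <= 2 * (L * m) by rewrite mulr_ge0// mulr_ge0// ltW.
have eta2 : 0 < eta / 2 by rewrite divr_gt0.
have [eps [eps0 eps1 epsP]] := eps_choice Lm0 eta2.
pose eta1 := eta / 10; have eta10 : 0 < eta1 by rewrite divr_gt0.
have [h0 h00 mcons] :=
  mollify_consistent e_sub alpha01 e_cons eps0 eps1 (ltW K0) (ltW L0) eta10.
pose hs := h0 / 2; have hs0 : 0 < hs by rewrite divr_gt0.
have hs_lt : hs < h0 by rewrite /hs; lra.
have C40 : 0 <= 4 * C by lra.
have [del [del0 _ delP]] := eps_choice C40 (mulr_gt0 eta10 hs0).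
pose t := Num.min hs del.
have t0 : 0 < t by rewrite lt_min hs0.
exists (Num.bound t^-1) => n n' x Nn Nn'.
have small k : (Num.bound t^-1 < k)%N -> s / k%:R < h0 /\ s / k%:R <= del.
  move=> Nk; have k0 : 0 < k%:R :> R by rewrite ltr0n (leq_trans _ Nk).
  have tk : s / k%:R <= t.
    rewrite ler_pdivrMr//; apply: le_trans s1 _.
    rewrite -ler_pdivrMl// mulr1.
    apply: le_trans (ltW (archi_boundP (ltW _))) _; first by rewrite invr_gt0.
    by rewrite ler_nat ltnW.
  move: tk; rewrite le_min => /andP[tk1 tk2]; split=> //.
  exact: le_lt_trans hs_lt.
have [n1 n2] := small n Nn; have [n'1 n'2] := small n' Nn'.
have n_gt0 : (0 < n)%N by exact: leq_ltn_trans Nn.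
have n'_gt0 : (0 < n')%N by exact: leq_ltn_trans Nn'.
have nn' : 2 * C * (s / n%:R + s / n'%:R) <= eta1 * hs.
  apply: le_trans delP.
  have -> : 4 * C * del = 2 * C * (del + del) by ring.
  by apply: ler_wpM2l; [rewrite mulr_ge0|exact: lerD].
apply: le_trans (iter_le_iter eps0 eps1 (ltW L0) hs0 hs_lt phib s0 n_gt0 n'_gt0
  mcons CP n1 n'1 nn' x) _.
have e1 : 2 * (L * eps * m) <= eta / 2 by move: epsP; rewrite !mulrA [_ * m * eps]mulrAC.
have e2 : 5 * eta1 * s <= eta / 2.
  by rewrite /eta1; have := ler_wpM2l (ltW eta0) s1; lra.
by rewrite -/m; lra.
Qed.

(* [phi + t * g], with [g] a smooth approximation of the generator [G], is an
   approximate solution for small times. *)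
Lemma iter_upper phi g (G : V -> R) (h0 eta C : R) :
  bLip phi -> bLip g -> 0 <= C ->
  (forall h, 0 < h < h0 -> forall x, `|T h phi x - phi x - h * G x| <= eta * h) ->
  (forall x, `|g x - G x| <= eta) ->
  (forall h x, 0 <= h -> `|T h g x - g x| <= C * h) ->
  forall s h k x, 0 < h < h0 -> k%:R * h <= s ->
    iter k (T h) phi x <= phi x + k%:R * h * g x + k%:R * h * (2 * eta + C * s).
Proof.
move=> phib gb C0 GP gG gC s h k x hh0; have /andP[h_gt0 _] := hh0.
elim: k x => [|k ih] x ks /=; first by rewrite !mul0r !addr0.
have ks' : k%:R * h <= s by apply: le_trans ks; rewrite ler_pM2r// ler_nat.
have [K [L [_ _ phiKL]]] := bLip_blip phib.
have kh0 : 0 <= k%:R * h by rewrite mulr_ge0// ltW.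
have itb := blip_bLip (blip_iter_step (h `^ alpha^-1) e_sub k phiKL).
have pgb := bLipD phib (bLipZ (k%:R * h) gb).
apply: le_trans (step_leD _ e_sub itb pgb (fun y => ih y ks') x) _.
have h1 := stepD (h `^ alpha^-1) e_sub x phib (bLipZ (k%:R * h) gb).
rewrite stepZ// in h1.
have := GP _ hh0 x; have := gG x; have := gC h x (ltW h_gt0).
rewrite !ler_norml => /andP[_ a1] /andP[a2 _] /andP[_ a3].
have b1 := ler_wpM2l kh0 a1; have b2 := ler_wpM2l (ltW h_gt0) a2.
have b3 := ler_wpM2r (mulr_ge0 C0 (ltW h_gt0)) ks'.
rewrite -[k.+1%:R]natr1; move: h1 a3 b1 b2 b3; rewrite /tstep.
move: (step _ _ _ _) (step _ _ _ _) (step _ _ _ _) => x1 x2 x3.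
by move=> *; lra.
Qed.

(** Sublinearity gives no direct lower bound for [T (phi + t * g)]. Writing [phi] as
    [(phi + t * g) + t * (- g)] yields one in terms of [T phi] and [T (- g)], so the rate is
    required for [- g]. *)
Lemma iter_lower phi g (G : V -> R) (h0 eta C : R) :
  bLip phi -> bLip g -> 0 <= C ->
  (forall h, 0 < h < h0 -> forall x, `|T h phi x - phi x - h * G x| <= eta * h) ->
  (forall x, `|g x - G x| <= eta) ->
  (forall h x, 0 <= h -> `|T h (fun y => -1 * g y) x - -1 * g x| <= C * h) ->
  forall s h k x, 0 < h < h0 -> k%:R * h <= s ->
    phi x + k%:R * h * g x - k%:R * h * (2 * eta + C * s) <= iter k (T h) phi x.
Proof.
move=> phib gb C0 GP gG gC s h k x hh0; have /andP[h_gt0 _] := hh0.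
elim: k x => [|k ih] x ks /=; first by rewrite !mul0r addr0 subr0.
have ks' : k%:R * h <= s by apply: le_trans ks; rewrite ler_pM2r// ler_nat.
have [K [L [_ _ phiKL]]] := bLip_blip phib.
have kh0 : 0 <= k%:R * h by rewrite mulr_ge0// ltW.
have itb := blip_bLip (blip_iter_step (h `^ alpha^-1) e_sub k phiKL).
have pgb := bLipD phib (bLipZ (k%:R * h) gb).
have ngb : bLip (fun y => -1 * g y) by exact: bLipZ.
have step1 := step_leD (h `^ alpha^-1) e_sub pgb itb
  (c := k%:R * h * (2 * eta + C * s)) _ x.
have {}step1 := step1 (fun y => ltac:(rewrite -lerBlDr; exact: ih)).
have h1 := stepD (h `^ alpha^-1) e_sub x pgb (bLipZ (k%:R * h) ngb).
rewrite stepZ// in h1.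
rewrite (_ : (fun y => phi y + k%:R * h * g y + k%:R * h * (-1 * g y)) = phi) in h1;
  last by apply/funext => y; ring.
have := GP _ hh0 x; have := gG x; have := gC h x (ltW h_gt0).
rewrite !ler_norml => /andP[_ a1] /andP[_ a2] /andP[a3 _].
have b1 := ler_wpM2l kh0 a1; have b2 := ler_wpM2l (ltW h_gt0) a2.
have b3 := ler_wpM2r (mulr_ge0 C0 (ltW h_gt0)) ks'.
rewrite -[k.+1%:R]natr1; move: step1 h1 a3 b1 b2 b3; rewrite /tstep.
move: (step _ _ _ _) (step _ _ _ _) (step _ _ _ _) (step _ _ _ _) => x1 x2 x3 x4.
by move=> *; lra.
Qed.

Lemma iter_generator phi (G : V -> R) (eta : R) : Cb3 phi -> 0 < eta ->
  (forall eta, 0 < eta -> exists2 h0, 0 < h0 & forall h, 0 < h < h0 -> forall x,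
      `|T h phi x - phi x - h * G x| <= eta * h) ->
  exists2 s0, 0 < s0 & forall s n x, 0 < s < s0 -> (0 < n)%N ->
    `|iter n (T (s / n%:R)) phi x - phi x - s * G x| <= eta * s.
Proof.
move=> phiC eta0 GP; have phib := Cb3_bLip phiC.
pose eta1 := eta / 6; have eta10 : 0 < eta1 by rewrite divr_gt0.
have eta12 : 0 < eta1 / 2 by rewrite divr_gt0.
have [h0 h00 hP] := GP _ eta12.
pose hs := h0 / 2; have hs0 : 0 < hs by rewrite divr_gt0.
have hs_lt : 0 < hs < h0 by rewrite hs0/= /hs; lra.
(* [G] comes without regularity, but this quotient is bounded Lipschitz and uniformly close to it;
   mollifying it gives a [Cb3] approximation. *)
pose v x := hs^-1 * (T hs phi x - phi x).
have vb : bLip v by apply/bLipZ/bLipB => //; exact: bLip_step.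
have [K [L [K0 L0 vKL]]] := bLip_blip vb.
pose m : R := (size (@word3 d))%:R.
have Lm0 : 0 <= L * m by rewrite mulr_ge0// ltW.
have [eps [eps0 eps1 epsP]] := eps_choice Lm0 eta12.
pose g := avgs eps (@word3 d) v.
have gC : Cb3 g by exact: Cb3_avgs.
have ngC : Cb3 (fun x => -1 * g x).
  by have := Cb3_avgs eps0 (bLipZ (-1) vb); rewrite avgsZ.
have gb := Cb3_bLip gC.
have vG x : `|v x - G x| <= eta1 / 2.
  have := hP _ hs_lt x; have -> : T hs phi x - phi x = hs * v x.
    by rewrite /v mulrA mulfV ?mul1r// gt_eqF.
  by rewrite -mulrBr normrM (gtr0_norm hs0) [eta1 / 2 * hs]mulrC ler_pM2l.
have gG x : `|g x - G x| <= eta1.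
  rewrite -(subrKA (v x)); apply: le_trans (ler_normD _ _) _.
  have := avgs_close eps0 word3 x (ltW L0) vKL; have := vG x.
  by move: epsP; rewrite -/m -/g mulrAC; lra.
have [C1 C10 gC1] := tstep_rate e_sub alpha01 e_cons gC.
have [C2 C20 gC2] := tstep_rate e_sub alpha01 e_cons ngC.
have [h1 h10 h1P] := GP _ eta10.
have C120 : 0 <= C1 + C2 by lra.
have [del [del0 _ delP]] := eps_choice C120 eta10.
exists (Num.min h1 del); first by rewrite lt_min h10.
move=> s n x /andP[s0]; rewrite lt_min => /andP[sh1 sdel] n0.
have n0R : 0 < n%:R :> R by rewrite ltr0n.
have hh : 0 < s / n%:R < h1.
  rewrite divr_gt0//=; apply: le_lt_trans sh1.
  by rewrite ler_pdivrMr// ler_peMr ?(ltW s0)// ler1n.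
have nE : n%:R * (s / n%:R) = s by rewrite mulrC divfK// gt_eqF.
have nle : n%:R * (s / n%:R) <= s by rewrite nE.
have up := iter_upper phib gb C10 h1P gG gC1 x hh nle.
have lo := iter_lower phib gb C20 h1P gG gC2 x hh nle.
rewrite nE in up lo.
have := gG x; rewrite !ler_norml => /andP[g1 g2].
have b1 := ler_wpM2l (ltW s0) g1; have b2 := ler_wpM2l (ltW s0) g2.
have c12 : s * ((C1 + C2) * s) <= s * eta1.
  apply: ler_wpM2l; first exact: ltW.
  by apply: le_trans delP; apply: ler_wpM2l => //; exact: ltW.
have c1 : 0 <= s * (C1 * s) by rewrite !mulr_ge0// ltW.
have c2 : 0 <= s * (C2 * s) by rewrite !mulr_ge0// ltW.
have E : eta = 6 * eta1 by rewrite /eta1; lra.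
rewrite E; move: up lo; move: (iter _ _ _ _) => q up lo.
by apply/andP; split; lra.
Qed.

End convergence.

(** * Expectations of partial sums as iterates of the step operator *)

Section random_walk.
Context {R : realType} {d : nat} {Omega : Type}.
Local Notation V := 'rV[R]_d.
Variables (H : set (Omega -> R)) (E : (Omega -> R) -> R) (Z : nat -> Omega -> V).
Hypotheses (E_sub : sublinear_expectation H E) (Z_iid : iid H E Z).

Definition law (v : V -> R) : R := E (v \o Z 0%N).

Lemma law_sublinear : sublinear_law law.
Proof.
case: E_sub => _ _ _ _ [mono cst add hom]; case: Z_iid => _ [Zr _].
split.
- by move=> v w vb wb vw; apply: mono; [exact: Zr|exact: Zr|move=> o /=].
- by move=> c; exact: cst.
- by move=> v w vb wb; apply: add; exact: Zr.
- by move=> c v vb c0; apply: hom => //; exact: Zr.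
Qed.

Lemma iid_law i v : bLip v -> E (v \o Z i) = law v.
Proof.
case: Z_iid => _ [_ [Zid _]] vb; elim: i => // i <-; exact: Zid.
Qed.

(** Independence is tested on functions of the matrix of all variables, so a function of their sum
    has to be bounded Lipschitz in that matrix. *)
Lemma bLip_rows_sum m v (x : V) (a : R) : bLip v ->
  bLip (fun A : 'M[R]_(m, d) => v (x + a *: \sum_i row i A)).
Proof.
move=> vb; have [K [L [_ L0 [vK vL]]]] := bLip_blip (bLip_affine x a vb).
split; first by exists K.
exists (L * m%:R) => A B; apply: le_trans (vL _ _) _.
rewrite -mulrA; apply: ler_wpM2l; first exact: ltW.
rewrite -sumrB; apply: le_trans (ler_norm_sum _ _ _) _.
rewrite -[m in m%:R]card_ord -sum1_card natr_sum mulr_suml.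
apply: ler_sum => i _; rewrite mul1r -linearB/=.
by apply: norm_le_coord => // j; rewrite mxE; exact: mx_entry_le.
Qed.

Lemma expect_partial_sum a n v x : bLip v ->
  E (fun w => v (x + a *: partial_sum Z n w)) = iter n (step law a) v x.
Proof.
case: n => [|n].
  move=> _; have [_ _ _ _ [_ Ecst _ _]] := E_sub; rewrite -[RHS]Ecst.
  by congr E; apply/funext => w; rewrite /partial_sum big_ord0 scaler0 addr0.
elim: n v => [|n ih] v vb.
  rewrite /= /step /law; congr E; apply/funext => w /=.
  by rewrite /partial_sum big_ord1.
(* The last summand is integrated first, with the earlier ones frozen, so it corresponds to the
   innermost application of the step. *)
rewrite iterSr -ih; last exact: (bLip_step a law_sublinear vb).
case: Z_iid => _ [_ [_ Zind]].
pose phi (A : 'M[R]_(n.+1 + 1, d)) := v (x + a *: \sum_i row i A).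
have phiE w w' : phi (col_mx (first_rows Z n.+1 w) (Z n.+1 w')) =
    v (x + a *: partial_sum Z n.+1 w + a *: Z n.+1 w').
  rewrite /phi big_split_ord/= big_ord1 rowKd -addrA -scalerDr.
  congr (v (x + a *: (_ + _))); last by apply/rowP => j; rewrite mxE.
  by apply: eq_bigr => i _; rewrite rowKu; apply/rowP => j; rewrite !mxE.
transitivity (E (fun w => phi (col_mx (first_rows Z n.+1 w) (Z n.+1 w)))).
  congr E; apply/funext => w; rewrite phiE /partial_sum big_ord_recr/=.
  by rewrite scalerDr addrA.
rewrite (Zind n phi (bLip_rows_sum _ x a vb)); congr E; apply/funext => w.
rewrite /step -(iid_law n.+1); last exact: bLip_affine.
by congr E; apply/funext => w'; rewrite phiE.
Qed.

End random_walk.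

(** * The limit theorem *)

Lemma near0_right (R : realType) (P : R -> Prop) :
  (\forall h \near 0^'+, P h) -> exists2 h0, 0 < h0 & forall h, 0 < h < h0 -> P h.
Proof.
case/nbhs_ballP => r /= r0 rP; exists r => // h /andP[h0 hr]; apply: rP => //.
by rewrite /ball/= sub0r normrN gtr0_norm.
Qed.

Theorem theorem4p4 (R : realType) (d : nat) (alpha Llo Lhi : R)
    (Omega : Type) (H : set (Omega -> R)) (E : (Omega -> R) -> R)
    (Z : nat -> Omega -> 'rV[R]_d) :
  0 < alpha <= 1 -> 0 < Llo -> 0 < Lhi ->
  sublinear_expectation H E ->
  iid H E Z ->
  (forall i, Eup E (Z i) (@eucl R d) = +oo%E) ->
  (* (A1) *)
  (exists delta : R, 0 < delta < alpha /\
     exists M : R, forall n : nat, (0 < n)%N ->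
       (Eup E (fun w => ((n%:R `^ (- alpha^-1)) *: partial_sum Z n w)%R)
            (fun y => (eucl y `^ delta)%R) <= M%:E)%E) ->
  (* (A2) *)
  (forall phi : 'rV[R]_d -> R, Cb3 phi ->
     exists l : R -> R, (l x @[x --> 0^'+] --> 0) /\
       forall s : R, 0 < s <= 1 -> forall x : 'rV[R]_d,
         s^-1 * `| E (fun w => phi (x + (s `^ alpha^-1) *: Z 0%N w) - phi x)
                   - s * jump_sup alpha Llo Lhi phi x | <= l s) ->
  (* conclusion *)
  forall phi : 'rV[R]_d -> R, Cb3 phi ->
    exists rho : R -> R, (rho s / s @[s --> 0^'+] --> 0) /\
      forall s : R, 0 <= s <= 1 -> forall x : 'rV[R]_d,
        let A := fun n : nat =>
          `| E (fun w => phi (x + ((s / n%:R) `^ alpha^-1) *: partial_sum Z n w))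
             - phi x - s * jump_sup alpha Llo Lhi phi x | in
        cvgn A /\ limn A <= rho s.
Proof.
move=> alpha01 _ _ E_sub Z_iid _ _ A2 phi phiC.
pose e := law E Z; have e_sub : sublinear_law e by exact: law_sublinear Z_iid.
have cons psi : Cb3 psi -> forall eta, 0 < eta -> exists2 h0, 0 < h0 &
    forall h, 0 < h < h0 -> forall x, `|tstep e alpha h psi x - psi x
      - h * jump_sup alpha Llo Lhi psi x| <= eta * h.
  move=> psiC eta eta0; have [l [l0 lP]] := A2 _ psiC.
  have psib := Cb3_bLip psiC.
  have /near0_right[h0 h00 hP] : \forall h \near 0^'+, `|0 - l h| <= eta.
    by move: eta eta0; exact/cvgrPdist_le.
  exists (Num.min h0 1); first by rewrite lt_min h00/=.
  move=> h; rewrite lt_min => /and3P[h_gt0 hh0 h1] x.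
  have h01 : 0 < h <= 1 by rewrite h_gt0 ltW.
  have hh : 0 < h < h0 by rewrite h_gt0.
  have := lP _ h01 x; have := hP _ hh; rewrite sub0r normrN => lh.
  have -> : E (fun w => psi (x + (h `^ alpha^-1) *: Z 0%N w) - psi x) =
      tstep e alpha h psi x - psi x.
    by rewrite /tstep -(step_addc _ e_sub).
  rewrite ler_pdivrMl// => /le_trans; apply; rewrite mulrC ler_pM2r//.
  exact: le_trans (ler_norm _) lh.
have e_cons : consistent e alpha.
  by move=> psi psiC; exists (jump_sup alpha Llo Lhi psi); exact: cons.
set G := jump_sup alpha Llo Lhi phi.
have phib := Cb3_bLip phiC; have [K [L [K0 L0 phiKL]]] := bLip_blip phib.
have [C C0 CP] := tstep_rate e_sub alpha01 e_cons phiC.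
pose u s n := iter n (tstep e alpha (s / n%:R)) phi.
have GB x : `|G x| <= C + 1.
  have [h0 h00 hP] := cons _ phiC _ ltr01; pose h := h0 / 2.
  have h_gt0 : 0 < h by rewrite divr_gt0.
  have hh : 0 < h < h0 by rewrite h_gt0/= /h; lra.
  have := hP _ hh x; have := CP h x (ltW h_gt0); rewrite mul1r -/G.
  set q := tstep e alpha h phi x - phi x => h1 h2.
  rewrite -(ler_pM2l h_gt0) -{1}(gtr0_norm h_gt0) -normrM.
  rewrite (_ : h * G x = q - (q - h * G x)); last by ring.
  by apply: le_trans (ler_normB _ _) _; lra.
(* The remainder is the supremum of the errors over all [n >= 1] and all [x]. Uniformity in [x] is
   then built in, and the bound on the limit follows from the bound on each term. *)
pose S s := [set r : R | exists n x, (0 < n)%N /\ r = `|u s n x - phi x - s * G x|].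
have S_ne s : S s !=set0 by exists `|u s 1%N 0 - phi 0 - s * G 0|, 1%N, 0.
have S_ub s : has_ubound (S s).
  exists (K + K + `|s| * (C + 1)) => r [n [x [_ ->]]].
  apply: le_trans (ler_normB _ _) _; apply: lerD.
    apply: le_trans (ler_normB _ _) _; apply: lerD; last exact: phiKL.1.
    exact: (blip_iter_step _ e_sub n phiKL).1.
  by rewrite normrM ler_wpM2l.
exists (fun s => sup (S s)); split.
  apply/cvgrPdist_le => eta eta0.
  have [s0 s00 sP] := iter_generator e_sub alpha01 e_cons phiC eta0 (cons _ phiC).
  near=> s; have s_gt0 : 0 < s by near: s; exact: nbhs_right_gt.
  have ss0 : 0 < s < s0 by rewrite s_gt0/=; near: s; exact: nbhs_right_lt.
  rewrite sub0r normrN normrM normfV (gtr0_norm s_gt0) ler_pdivrMr//.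
  rewrite ger0_norm; first by apply: ge_sup => // r [n [x [n0 ->]]]; exact: sP.
  apply: le_trans (ub_le_sup (S_ub s) (_ : S s `|u s 1%N 0 - phi 0 - s * G 0|)) => //.
  by exists 1%N, 0.
move=> s /andP[s_ge0 s_le1] x A.
have -> : A = fun n => `|u s n x - phi x - s * G x|.
  by apply/funext => n; rewrite /A (expect_partial_sum E_sub Z_iid).
have u_cauchy eta : 0 < eta -> exists N, forall n n', (N < n)%N -> (N < n')%N ->
    u s n x <= u s n' x + eta.
  move=> eta0; move: s_ge0; rewrite le_eqVlt => /predU1P[s0|s_gt0].
    (* At [s = 0] every step is the identity, so the sequence is constant. *)
    exists 0%N => n n' _ _; rewrite /u -s0 !mul0r.
    have itE k : iter k (tstep e alpha 0) phi = phi.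
      by elim: k => //= k ->; exact: tstep0.
    by rewrite !itE lerDl ltW.
  have s01 : 0 < s <= 1 by rewrite s_gt0.
  have [N NP] := iter_cauchy e_sub alpha01 e_cons phiC s01 eta0.
  by exists N => n n' Nn Nn'; exact: NP.
have u_cvg : cvgn (fun n => u s n x).
  apply: cauchy_cvg; apply: cauchy_exP => eta eta0.
  have eta2 : 0 < eta / 2 by rewrite divr_gt0.
  have [N NP] := u_cauchy _ eta2; exists (u s N.+1 x).
  exists N.+1 => // n /= Nn; rewrite /ball/=.
  have a1 := NP N.+1 n (ltnSn N) Nn; have a2 := NP n N.+1 Nn (ltnSn N).
  by rewrite ltr_norml; apply/andP; split; lra.
have A_cvg : cvgn (fun n => `|u s n x - phi x - s * G x|).
  apply: is_cvg_norm; apply: is_cvgB; last exact: is_cvg_cst.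
  by apply: is_cvgB => //; exact: is_cvg_cst.
split=> //; apply: limr_le => //.
near=> n; apply: ub_le_sup => //; exists n, x; split=> //.
by near: n; exact: nbhs_infty_gt.
Unshelve. all: by end_near. Qed.
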